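(* Let $N\in\mathbb Z_{>0}$, $k\in\mathbb Z_{\ge0}$, and $m\in\frac52+\mathbb Z_{\ge0}$. Let $\Gamma$ be a subgroup of $\mathbf\Gamma(N)$ such that $\Gamma\cap K=\{1\}$. If $$N>\frac{4\,\mathrm M\left(\frac k2+1,\frac m2-1\right)^{\frac12}}{1-\mathrm M\left(\frac k2+1,\frac m2-1\right)},$$ then $P_\Gamma F_{k,m}$ is not identically $0$.
   Context: Let $\mathcal H=\{z\in\mathbb C:\Im z>0\}$, let $\mathrm{Hol}(\mathcal H)$ be the space of holomorphic functions on $\mathcal H$, and let $g.z=\frac{az+b}{cz+d}$, $j(g,z)=cz+d$ for $g=\begin{pmatrix}a&b\\c&d\end{pmatrix}$. The square root $\sqrt{\cdot}$ is the branch with values in $\{\Re>0\}\cup\{\Re=0,\Im\ge0\}$, and $z^m:=(\sqrt z)^{2m}$ for half-integral $m$. The metaplectic group is $\mathrm{SL}_2(\mathbb R)^\sim=\{\sigma=(g_\sigma,\eta_\sigma)\in\mathrm{SL}_2(\mathbb R)\times\mathrm{Hol}(\mathcal H):\eta_\sigma(z)^2=j(g_\sigma,z)\ \forall z\in\mathcal H\}$ with multiplication $\sigma_1\sigma_2=(g_{\sigma_1}g_{\sigma_2},\ \eta_{\sigma_1}(g_{\sigma_2}.z)\eta_{\sigma_2}(z))$; it is a double cover of $\mathrm{SL}_2(\mathbb R)$ via $\pi_1(\sigma)=g_\sigma$. $K=\pi_1^{-1}(\mathrm{SO}_2(\mathbb R))$. For $N\in\mathbb Z_{>0}$, $\mathbf\Gamma(N)=\pi_1^{-1}(\Gamma(N))$,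 where $\Gamma(N)=\left\{\begin{pmatrix}a&b\\c&d\end{pmatrix}\in\mathrm{SL}_2(\mathbb Z):a,d\equiv1,\ b,c\equiv0\ (\mathrm{mod}\ N)\right\}$; it is a discrete subgroup of $\mathrm{SL}_2(\mathbb R)^\sim$. For $k\in\mathbb Z_{\ge0}$ and $m\in\frac52+\mathbb Z_{\ge0}$, $f_{k,m}(z)=(2i)^m\frac{(z-i)^k}{(z+i)^{m+k}}$ for $z\in\mathcal H$, and $F_{k,m}(\sigma)=f_{k,m}(g_\sigma.i)\,\eta_\sigma(i)^{-2m}$ for $\sigma\in\mathrm{SL}_2(\mathbb R)^\sim$. $(P_\Gamma F_{k,m})(\sigma)=\sum_{\gamma\in\Gamma}F_{k,m}(\gamma\sigma)$; for discrete $\Gamma$ this series converges absolutely and uniformly on compact sets. For $a,b\in\mathbb R_{>0}$, $\mathrm M(a,b)$ denotes the median of the beta distribution $B(a,b)$, i.e. the unique $\mathrm M(a,b)\in\,]0,1[$ such that $\int_0^{\mathrm M(a,b)}x^{a-1}(1-x)^{b-1}\,dx=\int_{\mathrm M(a,b)}^1x^{a-1}(1-x)^{b-1}\,dx$. *)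

(* Defs.v *)
From HB Require Import structures.
From mathcomp Require Import all_boot all_order all_algebra.
From mathcomp Require Import all_classical all_reals all_analysis.
From mathcomp Require Import complex.
From mathcomp Require summability.
From mathcomp Require Import ring.

Set Implicit Arguments.
Unset Strict Implicit.
Unset Printing Implicit Defensive.
Import Order.TTheory GRing.Theory Num.Theory numFieldNormedType.Exports.
Local Open Scope classical_set_scope.
Local Open Scope ring_scope.
Local Open Scope complex_scope.

(* [sqrtc] is the branch of the square root with values in
   {Re > 0} \cup {Re = 0, Im >= 0}. *)
Lemma sqrtc_branch (R : rcfType) (z : R[i]) :
  0 < complex.Re (sqrtc z)
  \/ complex.Re (sqrtc z) = 0 /\ 0 <= complex.Im (sqrtc z).
Proof.
case: z => a b; rewrite /sqrtc /=.
set r := Num.sqrt (_ + _).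
have [ra|ra] := ltP 0 (Num.sqrt ((r + a) / 2)); first by left.
right; split; first by apply/eqP; rewrite eq_le ra sqrtr_ge0.
have [_|b0] := eqVneq b 0; first by rewrite mul1r sqrtr_ge0.
have ar : `|a| < r.
  have r0 : 0 < a ^+ 2 + b ^+ 2.
    by rewrite ltr_wpDl ?sqr_ge0// exprn_even_gt0.
  by rewrite -sqrtr_sqr ltr_sqrt// ltrDl exprn_even_gt0.
have ra0 : 0 < r + a.
  by move: ar; rewrite ltr_norml => /andP[+ _]; rewrite -subr_gt0 opprK addrC.
by move: ra; rewrite leNgt sqrtr_gt0 divr_gt0.
Qed.

Section HalfIntegralPowers.
Variable R : realType.

(* The integer [2 m], for half-integral or integral [m]. *)
Definition twice (m : R) : int := Num.floor (2 * m).

Lemma twiceE (m : R) : (exists n : int, 2 * m = n%:~R) -> (twice m)%:~R = 2 * m.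
Proof. by rewrite /twice => -[n ->]; rewrite intrKfloor. Qed.

(* [z ^ m = (sqrt z) ^ (2 m)] *)
Definition half_pow (z : R[i]) (m : R) : R[i] := sqrtc z ^ twice m.

End HalfIntegralPowers.

Lemma numField_derivable_comp (K : numFieldType) (f g : K -> K) (x : K) :
  derivable f x 1 -> derivable g (f x) 1 -> derivable (g \o f) x 1.
Proof.
move=> /derivable1_diffP df /derivable1_diffP dg.
by apply/derivable1_diffP; exact: differentiable_comp.
Qed.

Section UpperHalfPlane.
Variable R : realType.

Definition upper_half : Type := {z : R[i] | 0 < complex.Im z}.

Definition extend0 (f : upper_half -> R[i]) (w : R[i]) : R[i] :=
  oapp f 0 (insub w).

(* Complex differentiability at every point of the upper half-plane.  It is a
   local condition and the half-plane is open, so it does not depend on the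
   values given to [f] outside; [R[i]^o] is [R[i]] as a normed module over
   itself. *)
Definition holomorphic (f : upper_half -> R[i]) : Prop :=
  forall z : upper_half,
    derivable (extend0 f : R[i]^o -> R[i]^o) (val z : R[i]^o) 1.

Lemma extend0E (f : upper_half -> R[i]) (z : upper_half) :
  extend0 f (val z) = f z.
Proof. by rewrite /extend0 valK. Qed.

Lemma near_upper_half (z : upper_half) :
  \forall w \near (val z : R[i]^o), 0 < complex.Im w.
Proof.
apply/nbhs_normP; exists (complex.Im (val z))%:C => /=.
  by rewrite ltcR (valP z).
move=> w; rewrite /= normc_def ltcR => h.
have : `|complex.Im (val z - w)| < complex.Im (val z).
  apply: le_lt_trans h; rewrite -sqrtr_sqr ler_wsqrtr// lerDr sqr_ge0//.
case: (val z) w {h} => x y [x' y'] /=; rewrite ltr_distlC => /andP[+ _].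
by rewrite subrr.
Qed.

Lemma holomorphic_ext (f : upper_half -> R[i]) (F : R[i]^o -> R[i]^o) :
  (forall z, f z = F (val z)) ->
  (forall z : upper_half, derivable F (val z : R[i]^o) 1) -> holomorphic f.
Proof.
move=> fF dF z; apply: near_eq_derivable (dF z).
near=> w.
have w0 : 0 < complex.Im (w : R[i]) by near: w; exact: near_upper_half.
have := extend0E f (exist _ w w0); rewrite fF /= => <-.
by [].
Unshelve. all: by end_near. Qed.

Lemma half_i_subproof : 0 < complex.Im ('i : R[i]).
Proof. exact: ltr01. Qed.

Definition half_i : upper_half := exist _ 'i half_i_subproof.

Record SL2 : Type := MkSL2 { SL2_mx :> 'M[R]_2 ; _ : \det SL2_mx == 1 }.

HB.instance Definition _ := [isSub for SL2_mx].
HB.instance Definition _ := [Choice of SL2 by <:].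

Lemma SL2_det (g : SL2) : \det g = 1.
Proof. exact/eqP/(valP g). Qed.

Lemma SL2_mul_subproof (g h : SL2) : \det (g *m h) == 1.
Proof. by rewrite det_mulmx !SL2_det mulr1. Qed.

Lemma SL2_one_subproof : \det (1%:M : 'M[R]_2) == 1.
Proof. by rewrite det1. Qed.

Lemma SL2_inv_subproof (g : SL2) : \det (invmx g) == 1.
Proof. by rewrite det_inv SL2_det invr1. Qed.

Definition SL2_mul (g h : SL2) : SL2 := MkSL2 (SL2_mul_subproof g h).
Definition SL2_one : SL2 := MkSL2 SL2_one_subproof.
Definition SL2_inv (g : SL2) : SL2 := MkSL2 (SL2_inv_subproof g).

Lemma SL2_unit (g : SL2) : SL2_mx g \in unitmx.
Proof. by rewrite unitmxE SL2_det unitr1. Qed.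

Lemma SL2_mulA : associative SL2_mul.
Proof. by move=> g h l; apply: val_inj; rewrite /= mulmxA. Qed.

Lemma SL2_mul1 : left_id SL2_one SL2_mul.
Proof. by move=> g; apply: val_inj; rewrite /= mul1mx. Qed.

Lemma SL2_mulr1 : right_id SL2_one SL2_mul.
Proof. by move=> g; apply: val_inj; rewrite /= mulmx1. Qed.

Lemma SL2_mulV : left_inverse SL2_one SL2_inv SL2_mul.
Proof. by move=> g; apply: val_inj; rewrite /= mulVmx// SL2_unit. Qed.

Lemma SL2_mulrV : right_inverse SL2_one SL2_inv SL2_mul.
Proof. by move=> g; apply: val_inj; rewrite /= mulmxV// SL2_unit. Qed.

HB.instance Definition _ := isGroup.Build SL2
  SL2_mulA SL2_mul1 SL2_mulr1 SL2_mulV SL2_mulrV.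

Definition autj (g : SL2) (z : R[i]) : R[i] :=
  (g 1 0)%:C * z + (g 1 1)%:C.

Definition mobius (g : SL2) (z : R[i]) : R[i] :=
  ((g 0 0)%:C * z + (g 0 1)%:C) / autj g z.

Lemma SL2_detE (g : SL2) :
  g 0 0 * g 1 1 - g 0 1 * g 1 0 = 1.
Proof.
rewrite -(SL2_det g).
rewrite (expand_det_row _ 0) !big_ord_recl big_ord0 addr0 /cofactor !det_mx11.
rewrite !mxE /= expr0 expr1 !mul1r mulN1r mulrN.
by congr (_ * g _ _ - g _ _ * g _ _); exact: val_inj.
Qed.

Lemma autj_neq0 (g : SL2) (z : R[i]) : 0 < complex.Im z -> autj g z != 0.
Proof.
case: z => x y /= y0; have := SL2_detE g; rewrite /autj.
case: g => g /= _.
move: (g 0 0) (g 0 1) (g 1 0) (g 1 1) => a b c d dt.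
apply/eqP; simpc => -[] h1 /eqP; rewrite mulf_eq0 (gt_eqF y0) orbF => /eqP c0.
move: h1 dt; rewrite c0 mul0r add0r => ->.
by rewrite !mulr0 subr0 => /esym/eqP; rewrite oner_eq0.
Qed.

Lemma Im_mobius (g : SL2) (z : R[i]) :
  0 < complex.Im z -> 0 < complex.Im (mobius g z).
Proof.
move=> z0; have := autj_neq0 g z0; move: z0.
rewrite /mobius; have := SL2_detE g; rewrite /autj.
case: z => x y /=; case: g => g /= _.
move: (g 0 0) (g 0 1) (g 1 0) (g 1 1) => a b c d dt y0.
simpc; rewrite -[X in 0 < X]/(_ + _) => j0.
have n0 : 0 < (c * x + d) ^+ 2 + (c * y) ^+ 2.
  rewrite lt_neqAle addr_ge0 ?sqr_ge0// andbT eq_sym.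
  apply: contra j0; rewrite paddr_eq0 ?sqr_ge0// !sqrf_eq0 => /andP[/eqP h /eqP h'].
  by rewrite h h'.
set n := (X in _ / X) in n0 *.
rewrite (_ : _ + _ = (a * d - b * c) * y / ((c * x + d) ^+ 2 + (c * y) ^+ 2)).
  by rewrite dt mul1r divr_gt0.
by rewrite /n; field; rewrite gt_eqF.
Qed.

Definition half_act (g : SL2) (z : upper_half) : upper_half :=
  exist _ (mobius g (val z)) (Im_mobius g (valP z)).

Lemma SL2_mulE (g h : SL2) i j : (g * h)%g i j = g i 0 * h 0 j + g i 1 * h 1 j.
Proof.
rewrite [LHS]mxE !big_ord_recl big_ord0 addr0.
by congr (_ + g _ _ * h _ _); exact: val_inj.
Qed.

Lemma autjM (g h : SL2) (z : upper_half) :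
  autj (g * h)%g (val z) = autj g (val (half_act h z)) * autj h (val z).
Proof.
have := autj_neq0 h (valP z); rewrite /= /mobius.
rewrite [autj g _]/autj [autj (_ * _)%g _]/autj !SL2_mulE !rmorphD !rmorphM /=.
set u := autj h _ => u0.
rewrite [RHS]mulrDl -[_ * (_ / u) * u]mulrA divfK// /u /autj.
by ring.
Qed.

Lemma half_actM (g h : SL2) (z : upper_half) :
  half_act (g * h)%g z = half_act g (half_act h z).
Proof.
apply: val_inj => /=; rewrite {1 2}/mobius autjM /=.
have g0 : autj g (mobius h (val z)) != 0 by exact: (autj_neq0 g (valP (half_act h z))).
have := autj_neq0 h (valP z).
rewrite !SL2_mulE !rmorphD !rmorphM /=.
move: g0; set v := autj g _ => v0; rewrite /mobius.
set u := autj h _ => u0.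

rewrite invfM [v^-1 * _]mulrC [LHS]mulrA; congr (_ / _).
apply: (canLR (mulfK u0)); rewrite [RHS]mulrDl -[_ * (_ / u) * u]mulrA divfK//.
by rewrite /u /autj; ring.
Qed.

Lemma half_act1 (z : upper_half) : half_act 1%g z = z.
Proof.
apply: val_inj => /=; rewrite /mobius /autj !mxE /=.
by rewrite mul1r mul0r addr0 add0r divr1.
Qed.

Lemma autj1 (z : R[i]) : autj 1%g z = 1.
Proof. by rewrite /autj !mxE /= mul0r add0r. Qed.

Lemma derivable_mobius (g : SL2) (z : upper_half) :
  derivable (mobius g : R[i]^o -> R[i]^o) (val z : R[i]^o) 1.
Proof.
have lin (a b : R[i]) :
    derivable (fun w : R[i]^o => a * w + b : R[i]^o) (val z : R[i]^o) 1.
  apply: derivableD; last exact: derivable_cst.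
  by apply: derivableZ; exact: derivable_id.
apply: (@derivableM R[i] R[i]^o); first exact: lin.
apply: (@derivableV R[i] R[i]^o); last exact: lin.
exact: (autj_neq0 g (valP z)).
Qed.

Lemma holomorphicM (f g : upper_half -> R[i]) :
  holomorphic f -> holomorphic g -> holomorphic (fun z => f z * g z).
Proof.
move=> hf hg.
apply: (@holomorphic_ext _ (fun w => extend0 f w * extend0 g w)) => [z|z].
  by rewrite !extend0E.
by apply: (@derivableM R[i] R[i]^o); [exact: hf|exact: hg].
Qed.

Lemma holomorphicV (f : upper_half -> R[i]) :
  (forall z, f z != 0) -> holomorphic f -> holomorphic (fun z => (f z)^-1).
Proof.
move=> f0 hf; apply: (@holomorphic_ext _ (fun w => (extend0 f w)^-1)) => [z|z].
  by rewrite extend0E.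
by apply: (@derivableV R[i] R[i]^o); [rewrite extend0E|exact: hf].
Qed.

Lemma holomorphic_act (g : SL2) (f : upper_half -> R[i]) :
  holomorphic f -> holomorphic (fun z => f (half_act g z)).
Proof.
move=> hf; apply: (@holomorphic_ext _ (extend0 f \o mobius g)) => [z|z].
  by rewrite -extend0E.
apply: (@numField_derivable_comp R[i]); first exact: derivable_mobius.
exact: (hf (half_act g z)).
Qed.

Lemma holomorphic1 : holomorphic (fun=> 1).
Proof.
by apply: (@holomorphic_ext _ (fun=> 1)) => // z; exact: derivable_cst.
Qed.

End UpperHalfPlane.

Section Metaplectic.
Variable R : realType.

Record metaplectic : Type := MkMetaplectic {
  mp_mx : SL2 R ;
  mp_eta : upper_half R -> R[i] ;
  mp_holo : holomorphic mp_eta ;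
  mp_sqr : forall z, mp_eta z ^+ 2 = autj mp_mx (val z) }.

HB.instance Definition _ := gen_eqMixin metaplectic.
HB.instance Definition _ := gen_choiceMixin metaplectic.

Lemma metaplectic_eq (s t : metaplectic) :
  mp_mx s = mp_mx t -> mp_eta s =1 mp_eta t -> s = t.
Proof.
case: s t => [g e h q] [g' e' h' q'] /= gg /funext ee.
by subst; congr MkMetaplectic; exact: Prop_irrelevance.
Qed.

Lemma mp_eta_neq0 (s : metaplectic) z : mp_eta s z != 0.
Proof. by rewrite -sqrf_eq0 mp_sqr (autj_neq0 _ (valP z)). Qed.

Lemma mp_mul_holo (s t : metaplectic) :
  holomorphic (fun z => mp_eta s (half_act (mp_mx t) z) * mp_eta t z).
Proof.
by apply: holomorphicM; [apply: holomorphic_act|]; exact: mp_holo.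
Qed.

Lemma mp_mul_sqr (s t : metaplectic) z :
  (mp_eta s (half_act (mp_mx t) z) * mp_eta t z) ^+ 2
  = autj (mp_mx s * mp_mx t)%g (val z).
Proof. by rewrite exprMn !mp_sqr autjM. Qed.

Definition mp_mul (s t : metaplectic) : metaplectic :=
  MkMetaplectic (@mp_mul_holo s t) (mp_mul_sqr s t).

Lemma mp_one_sqr (z : upper_half R) : (1 : R[i]) ^+ 2 = autj 1%g (val z).
Proof. by rewrite autj1 expr1n. Qed.

Definition mp_one : metaplectic := MkMetaplectic (@holomorphic1 R) mp_one_sqr.

Lemma mp_inv_holo (s : metaplectic) :
  holomorphic (fun z => (mp_eta s (half_act (mp_mx s)^-1%g z))^-1).
Proof.
apply: holomorphicV => [z|]; first exact: mp_eta_neq0.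
by apply: holomorphic_act; exact: mp_holo.
Qed.

Lemma mp_inv_sqr (s : metaplectic) z :
  (mp_eta s (half_act (mp_mx s)^-1%g z))^-1 ^+ 2
  = autj (mp_mx s)^-1%g (val z).
Proof.
have h0 := autj_neq0 (mp_mx s) (valP (half_act (mp_mx s)^-1%g z)).
by rewrite exprVn mp_sqr; apply: (mulfI h0); rewrite divff// -autjM mulgV autj1.
Qed.

Definition mp_inv (s : metaplectic) : metaplectic :=
  MkMetaplectic (@mp_inv_holo s) (mp_inv_sqr s).

Lemma mp_mulA : associative mp_mul.
Proof.
move=> s t u; apply: metaplectic_eq => [|z] /=; first exact: mulgA.
by rewrite mulrA half_actM.
Qed.

Lemma mp_mul1 : left_id mp_one mp_mul.
Proof.
by move=> s; apply: metaplectic_eq => [|z] /=; [exact: mul1g|rewrite mul1r].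
Qed.

Lemma mp_mulr1 : right_id mp_one mp_mul.
Proof.
move=> s; apply: metaplectic_eq => [|z] /=; first exact: mulg1.
by rewrite half_act1 mulr1.
Qed.

Lemma mp_mulV : left_inverse mp_one mp_inv mp_mul.
Proof.
move=> s; apply: metaplectic_eq => [|z] /=; first exact: mulVg.
by rewrite -half_actM mulVg half_act1 mulVf ?mp_eta_neq0.
Qed.

Lemma mp_mulrV : right_inverse mp_one mp_inv mp_mul.
Proof.
move=> s; apply: metaplectic_eq => [|z] /=; first exact: mulgV.
by rewrite divff ?mp_eta_neq0.
Qed.

HB.instance Definition _ := isGroup.Build metaplectic
  mp_mulA mp_mul1 mp_mulr1 mp_mulV mp_mulrV.

Definition SO2 : set (SL2 R) := [set g : SL2 R | g *m (SL2_mx g)^T = 1%:M].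

(* Over [R], [\det g = 1] forces [\det A = 1]. *)
Definition principal_congruence (N : nat) : set (SL2 R) :=
  [set g : SL2 R | exists2 A : 'M[int]_2, SL2_mx g = map_mx intr A &
     forall i j, (A i j = (1%:M : 'M[int]_2) i j %[mod N])%Z].

Definition mp_K : set metaplectic := mp_mx @^-1` SO2.

Definition mp_Gamma (N : nat) : set metaplectic :=
  mp_mx @^-1` principal_congruence N.

Definition f_ (k : nat) (m : R) (z : upper_half R) : R[i] :=
  half_pow (2 * 'i) m * (val z - 'i) ^+ k / half_pow (val z + 'i) (m + k%:R).

Definition F_ (k : nat) (m : R) (s : metaplectic) : R[i] :=
  f_ k m (half_act (mp_mx s) (half_i R)) * mp_eta s (half_i R) ^ (- twice m).

(* [summability.sum] is the limit of the sums over finite subsets, directed by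
   inclusion; for an absolutely convergent family it is the usual sum. *)
Definition poincare (G : set metaplectic) (F : metaplectic -> R[i])
    (s : metaplectic) : R[i] :=
  summability.sum (fun g : G => F (val g * s)%g : R[i]^o).

End Metaplectic.

Section BetaMedian.
Variable R : realType.
Local Notation mu := (@lebesgue_measure R).

Definition beta_weight (a b x : R) : R := x `^ (a - 1) * (1 - x) `^ (b - 1).

Definition is_beta_median (a b M : R) : Prop :=
  0 < M < 1 /\
  (\int[mu]_(x in `[0%R, M]) (beta_weight a b x)%:E
   = \int[mu]_(x in `[M, 1%R]) (beta_weight a b x)%:E)%E.

(* The median exists and is unique for [a, b > 0]. *)
Definition beta_median (a b : R) : R := xget 0 (is_beta_median a b).

End BetaMedian.

(* Main.v *)
(* The absolute value [|F_ k m s|] depends only on [c = |g_s|^2 / 2] (which is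
   [cosh] of the hyperbolic distance from [i] to [g_s.i]).  Instead of the
   hyperbolic area we use Lebesgue measure on the cone of positive definite
   symmetric matrices [P] with [det P < 1]: there [P |-> g P g^T] is a product
   of shears, so that its invariance is only Fubini and translation invariance,
   and the law of [c] is proportional to Lebesgue measure on [1, +oo[.  With
   [x = (c - 1) / (c + 1)] this turns radial integrals of [|F_ k m|] into beta
   integrals, so a ball of radius slightly above the one given by the median
   carries more than half of the integral of [|F_ k m|].  The hypothesis on [N]
   makes the nontrivial translates of this ball under the group disjoint from
   it; integrating the sum of the nontrivial translates over the ball then
   yields a point at which the term of the identity dominates all others. *)
From HB Require Import structures.
Require Import Defs.
From mathcomp Require Import all_boot all_order all_algebra.
From mathcomp Require Import all_classical all_reals all_analysis.
From mathcomp Require Import complex.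
From mathcomp Require summability.
From mathcomp Require Import measurable_realfun ring lra.
Set Implicit Arguments.
Unset Strict Implicit.
Unset Printing Implicit Defensive.
Import Order.TTheory GRing.Theory Num.Theory numFieldNormedType.Exports.
Local Open Scope classical_set_scope.
Local Open Scope ring_scope.

(** * Invariance of integrals under shears *)

(** Both sides of the bound on [N] are values of c. If g in Gamma(N) is not in SO_2 and has rows (p,
    q) and (r, s), then one of the integers p - s, q + r is a nonzero multiple of N, and |gh|^2
    |h|^2 - 4 is at least (p - s)^2 + (q + r)^2. When h and gh both lie in the ball |.|^2 / 2 < C,
    the former is below 4 C^2 - 4, so C^2 = 1 + N^2 / 4 is a safe radius. The median x = M
    corresponds to c = (1 + M) / (1 - M), where c^2 = 1 + 4 M / (1 - M)^2; the hypothesis says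
    exactly that this c is below C. The beta parameters come from |F| = x^(k/2) (1 - x)^(m/2) and dc
    = 2 dx / (1 - x)^2. The second one, m/2 - 1, can be as small as 1/4, so the weight may blow up
    at 1; substitution and finiteness are therefore proved on inner segments and passed to the
    limit. The cut det P < 1 respects the action, which preserves det; as c ignores scaling of P,
    the cut only keeps the integral over the scaling direction finite. *)

Section LebesgueAffine.
Variable R : realType.
Local Notation mu := (@lebesgue_measure R).

Lemma measurable_affine (a b : R) : measurable_fun setT (fun x : R => a * x + b).
Proof. by apply: measurable_funD => //; exact: measurable_funM. Qed.

(** The image of Lebesgue measure under x -> a x + b, multiplied by |a|, agrees with Lebesgue
    measure on the half-open intervals, hence everywhere. *)
Lemma ge0_integral_affine (a b : R) (f : R -> \bar R) : a != 0 ->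
  measurable_fun setT f -> (forall x, (0 <= f x)%E) ->
  (\int[mu]_x f x = `|a|%:E * \int[mu]_x f (a * x + b)%R)%E.
Proof.
move=> a0 mf f0.
pose phi (x : measurableTypeR R) : measurableTypeR R := a * x + b.
have mphi : measurable_fun setT phi by exact: measurable_affine.
have na : 0 <= `|a| by [].
pose nu : {measure set (measurableTypeR R) -> \bar R} :=
    mscale (NngNum na) (measure_function_pushforward__canonical__measure_function_Measure mu mphi).
have H A : measurable A -> mu A = nu A.
  apply: lebesgue_measure_unique => X [[c d] _ <-] /=.
  rewrite /nu /mscale /pushforward/=.
  have E (x : R) : (a * x + b - b) / a = x by rewrite addrK mulrC mulKf.
  have D : (if (c < d)%O then d%:E - c%:E else 0)%E = (Num.max 0 (d - c))%:E :> \bar R.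
    by case: ifPn => cd; [rewrite max_r// subr_ge0 ltW|rewrite max_l// subr_le0 leNgt].
  (* The first branch is a < 0, whatever the name of its hypothesis: the map reverses the order, and
     the preimage of ]c, d] is closed on the left. *)
  have [a_gt0|a_lt0|] := ltgtP a 0; last by move/eqP; rewrite (negbTE a0).
    rewrite [X in (_ * mu X)%E](_ : _ = [set` `[(d - b) / a, (c - b) / a[]); last first.
      apply/seteqP; split=> x /=; rewrite !in_itv/= /phi ler_ndivrMr// ltr_ndivlMr//;
        by rewrite lerBrDr ltrBlDr mulrC andbC.
    rewrite !lebesgue_measure_itv/= !lte_fin D.
    rewrite ltr_nM2r ?invr_lt0// ltrD2r; case: ifPn => cd.
      rewrite -EFinB -EFinM ltr0_norm// max_r ?subr_ge0 ?ltW//; congr EFin; field => //.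
    by rewrite mule0 max_l// subr_le0 leNgt.
  rewrite [X in (_ * mu X)%E](_ : _ = [set` `](c - b) / a, (d - b) / a]]); last first.
    apply/seteqP; split=> x /=; rewrite !in_itv/= /phi ler_pdivlMr// ltr_pdivrMr//;
      by rewrite lerBrDr ltrBlDr mulrC.
  rewrite !lebesgue_measure_itv/= !lte_fin D.
  rewrite ltr_pM2r ?invr_gt0// ltrD2r; case: ifPn => cd.
    rewrite -EFinB -EFinM gtr0_norm// max_r ?subr_ge0 ?ltW//; congr EFin; field => //.
  by rewrite mule0 max_l// subr_le0 leNgt.
transitivity (\int[nu]_x f x)%E.
  by apply: eq_measure_integral => A mA _; exact: H.
rewrite ge0_integral_mscale//; congr (_ * _)%E.
by rewrite ge0_integral_pushforward.
Qed.

Lemma ge0_integral_translation (b : R) (f : R -> \bar R) :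
  measurable_fun setT f -> (forall x, (0 <= f x)%E) ->
  (\int[mu]_x f (x + b)%R = \int[mu]_x f x)%E.
Proof.
move=> mf f0; rewrite [RHS](@ge0_integral_affine 1 b)// ?oner_neq0//.
by rewrite normr1 mul1e; apply: eq_integral => x _; rewrite mul1r.
Qed.

End LebesgueAffine.

(** The image of [m1] under [phi] is [m2], expressed by integrals because Tonelli and composition
    produce this form directly. *)
Definition integral_preserving d1 d2 (T1 : measurableType d1)
    (T2 : measurableType d2) (R : realType) (m1 : set T1 -> \bar R)
    (m2 : set T2 -> \bar R) (phi : T1 -> T2) : Prop :=
  measurable_fun setT phi /\
  forall f : T2 -> \bar R, measurable_fun setT f -> (forall x, (0 <= f x)%E) ->
    (\int[m1]_x f (phi x) = \int[m2]_x f x)%E.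

Section IntegralPreserving.
Context d1 d2 d3 (T1 : measurableType d1) (T2 : measurableType d2)
  (T3 : measurableType d3) (R : realType).

Lemma integral_preserving_comp (m1 : set T1 -> \bar R) (m2 : set T2 -> \bar R)
    (m3 : set T3 -> \bar R) phi psi :
  integral_preserving m1 m2 phi -> integral_preserving m2 m3 psi ->
  integral_preserving m1 m3 (psi \o phi).
Proof.
move=> [mphi ephi] [mpsi epsi]; split; first exact: measurableT_comp mpsi mphi.
move=> f mf f0; rewrite -(epsi f mf f0) -(ephi (f \o psi))// => [|x].
  exact: measurableT_comp mf mpsi.
exact: f0.
Qed.

Lemma measurable_swap_prod : measurable_fun setT (fun x : T1 * T2 => (x.2, x.1)).
Proof.
apply: measurable_fun_pair; [exact: measurable_snd|exact: measurable_fst].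
Qed.

End IntegralPreserving.

Section SigmaFiniteProduct.
Context d1 d2 (T1 : measurableType d1) (T2 : measurableType d2) (R : realType).
Variables (m1 : {sigma_finite_measure set T1 -> \bar R})
  (m2 : {sigma_finite_measure set T2 -> \bar R}).

(** A named copy of the product measure carrying its own sigma-finite structure, so that products
    can be iterated. *)
Definition sprod : set (T1 * T2) -> \bar R := (m1 \x m2)%E.

HB.instance Definition _ := Measure.copy sprod (m1 \x m2)%E.

Lemma sprod_sigma_finite : sigma_finite setT sprod.
Proof.
have /sigma_finiteP[F [TF ndF Foo]] := sigma_finiteT m1.
have /sigma_finiteP[G [TG ndG Goo]] := sigma_finiteT m2.
exists (fun n => F n `*` G n).
  rewrite -setXTT TF TG; apply/seteqP; split=> -[x y] /=; last first.
    by move=> [n _ []/= ? ?]; split; exists n.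
  move=> [/= [n _ Fnx] [k _ Gky]]; exists (maxn n k) => //; split.
    by move: x Fnx; exact/subsetPset/ndF/leq_maxl.
  by move: y Gky; exact/subsetPset/ndG/leq_maxr.
move=> k; have [? ?] := Foo k; have [? ?] := Goo k.
split; first exact: measurableX.
by rewrite [X in (X < _)%E]product_measure1E// lte_mul_pinfty// ge0_fin_numE.
Qed.

HB.instance Definition _ :=
  Measure_isSigmaFinite.Build _ _ _ sprod sprod_sigma_finite.

Lemma ge0_integral_sprod1 (f : T1 * T2 -> \bar R) : measurable_fun setT f ->
  (forall x, (0 <= f x)%E) ->
  (\int[sprod]_z f z = \int[m1]_x \int[m2]_y f (x, y))%E.
Proof. exact: fubini_tonelli1. Qed.

Lemma ge0_integral_sprod2 (f : T1 * T2 -> \bar R) : measurable_fun setT f ->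
  (forall x, (0 <= f x)%E) ->
  (\int[sprod]_z f z = \int[m2]_y \int[m1]_x f (x, y))%E.
Proof. exact: fubini_tonelli2. Qed.

End SigmaFiniteProduct.

Section ProductMaps.
Context d1 d2 d3 (T1 : measurableType d1) (T2 : measurableType d2)
  (T3 : measurableType d3) (R : realType).
Variables (m1 : {sigma_finite_measure set T1 -> \bar R})
  (m2 : {sigma_finite_measure set T2 -> \bar R})
  (m3 : {sigma_finite_measure set T3 -> \bar R}).

Lemma integral_preserving_swap :
  integral_preserving (sprod m1 m2) (sprod m2 m1) (fun x => (x.2, x.1)).
Proof.
split=> [|f mf f0]; first exact: measurable_swap_prod.
rewrite [RHS]ge0_integral_sprod2// [LHS]ge0_integral_sprod1//.
exact: measurableT_comp mf (@measurable_swap_prod _ _ T1 T2).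
Qed.

Lemma integral_preserving_mapl phi : integral_preserving m1 m3 phi ->
  integral_preserving (sprod m1 m2) (sprod m3 m2) (fun x => (phi x.1, x.2)).
Proof.
move=> [mphi ephi].
have mpair : measurable_fun setT (fun x : T1 * T2 => (phi x.1, x.2)).
  apply: measurable_fun_pair; last exact: measurable_snd.
  exact: measurableT_comp mphi measurable_fst.
split=> [//|f mf f0].
rewrite [RHS]ge0_integral_sprod2// [LHS]ge0_integral_sprod2//; last first.
  exact: measurableT_comp mf mpair.
apply: eq_integral => y _; apply: (ephi (fun x => f (x, y))) => [|x]; last exact: f0.
exact: measurableT_comp mf (pair2_measurable y).
Qed.

Lemma integral_preserving_swap12 :
  integral_preserving (sprod (sprod m1 m2) m3) (sprod (sprod m1 m3) m2)
    (fun x => (x.1.1, x.2, x.1.2)).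
Proof.
have mpair : measurable_fun setT (fun x : T1 * T2 * T3 => (x.1.1, x.2, x.1.2)).
  have m1' : measurable_fun setT (fun x : T1 * T2 * T3 => x.1) by exact: measurable_fst.
  apply: measurable_fun_pair; last exact: (measurableT_comp measurable_snd m1').
  apply: measurable_fun_pair; last exact: measurable_snd.
  exact: (measurableT_comp measurable_fst m1').
split=> [//|f mf f0].
have mg := measurableT_comp mf mpair.
rewrite [RHS]ge0_integral_sprod1// [LHS]ge0_integral_sprod1//.
rewrite [RHS]ge0_integral_sprod1//; first last.
- by move=> x; exact: integral_ge0.
- exact: measurable_fun_fubini_tonelli_F.
rewrite [LHS]ge0_integral_sprod1//; first last.
- by move=> x; exact: integral_ge0.
- by apply: (@measurable_fun_fubini_tonelli_F _ _ _ _ R m3 _ mg) => x; exact: f0.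
apply: eq_integral => x _ /=.
apply: (@fubini_tonelli _ _ _ _ _ m2 m3 (fun y => f (x, y.2, y.1))) => [|y]; last exact: f0.
apply: (measurableT_comp (f := f)) => //.
apply: measurable_fun_pair; last exact: measurable_fst.
apply: measurable_fun_pair; last exact: measurable_snd.
exact: measurable_cst.
Qed.

End ProductMaps.

Section Shear.
Context d (T : measurableType d) (R : realType).
Variable m : {sigma_finite_measure set T -> \bar R}.
Local Notation mu := (@lebesgue_measure R).

Lemma integral_preserving_shear (a : T -> measurableTypeR R) :
  measurable_fun setT a ->
  integral_preserving (sprod m mu) (sprod m mu)
    (fun x => (x.1, (x.2 : R) + a x.1)).
Proof.
move=> ma.
have mpair : measurable_fun setT
    (fun x : T * measurableTypeR R => (x.1, (x.2 : measurableTypeR R) + a x.1)).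
  apply: measurable_fun_pair; first exact: measurable_fst.
  apply: measurable_funD; first exact: measurable_snd.
  exact: measurableT_comp ma measurable_fst.
split=> [//|f mf f0].
have mg := measurableT_comp mf mpair.
rewrite [RHS]ge0_integral_sprod1// [LHS](ge0_integral_sprod1 _ _ mg) => [|x]; last exact: f0.
apply: eq_integral => x _ /=.
apply: (@ge0_integral_translation R (a x) (fun y => f (x, y))) => [|y]; last exact: f0.
exact: measurableT_comp mf (pair1_measurable x).
Qed.
End Shear.

(** * Symmetric matrices *)

Ltac mfun := repeat first
  [ exact: measurable_cst | exact: measurable_id | exact: measurable_fst | exact: measurable_snd
  | assumption
  | apply: measurable_fun_pair
  | apply: measurable_funD | apply: measurable_funN | apply: measurable_funM
  | apply: measurable_funX
  | apply: (measurableT_comp measurable_fst)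
  | apply: (measurableT_comp measurable_snd)].

Section SymmetricMatrices.
Variable R : realType.
Local Notation T := (measurableTypeR R).
Local Notation mu := (@lebesgue_measure R).
Local Notation mu2 := (sprod mu mu).
Local Notation mu3 := (sprod mu2 mu).

(** The action P -> g P g^T for P with rows (alpha, beta) and (beta, delta). In the order (beta,
    delta, alpha), an upper unipotent g shears the last coordinate along the first two, then the
    first along the second. *)
Definition quad (a b c d : R) (P : R * R * R) : R * R * R :=
  let: (beta, delta, alpha) := P in
  (a * c * alpha + (a * d + b * c) * beta + b * d * delta,
   c ^+ 2 * alpha + c * d * beta *+ 2 + d ^+ 2 * delta,
   a ^+ 2 * alpha + a * b * beta *+ 2 + b ^+ 2 * delta).

Lemma quadM a b c d a' b' c' d' P :
  quad a b c d (quad a' b' c' d' P) =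
  quad (a * a' + b * c') (a * b' + b * d') (c * a' + d * c') (c * b' + d * d') P.
Proof. by case: P => [[x y] z]; congr (_, _, _); rewrite /=; ring. Qed.

Lemma shear12 (a : T -> T) : measurable_fun setT a ->
  integral_preserving mu2 mu2 (fun x : T * T => ((x.1 : R) + a x.2, x.2)).
Proof.
move=> ma.
exact: (integral_preserving_comp (integral_preserving_comp
  (integral_preserving_swap _ _) (integral_preserving_shear mu ma))
  (integral_preserving_swap _ _)).
Qed.

Lemma quad_upper x : integral_preserving mu3 mu3 (quad 1 x 0 1).
Proof.
have m1 : measurable_fun setT (fun q : T * T => (q.1 : R) * (x *+ 2) + (q.2 : R) * (x ^+ 2)).
  mfun.
have m2 : measurable_fun setT (fun q : T => (q : R) * x) by mfun.
have := integral_preserving_comp (integral_preserving_shear mu2 m1)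
  (integral_preserving_mapl mu (shear12 m2)).
congr integral_preserving; apply/funext => -[[p q] r] /=.
by congr (_, _, _); ring.
Qed.

(** This matrix has determinant -1 and exchanges the two diagonal entries; conjugation by it turns
    upper unipotents into lower ones. *)
Lemma quad_swap : integral_preserving mu3 mu3 (quad 0 1 1 0).
Proof.
have := integral_preserving_swap12 mu mu mu.
congr integral_preserving; apply/funext => -[[p q] r] /=.
by congr (_, _, _); ring.
Qed.

Lemma quad_lower x : integral_preserving mu3 mu3 (quad 1 0 x 1).
Proof.
have := integral_preserving_comp (integral_preserving_comp quad_swap (quad_upper x)) quad_swap.
congr integral_preserving; apply/funext => P /=; rewrite !quadM.
by congr quad; ring.
Qed.

(** For c != 0 the matrix is a product upper, lower, upper of unipotents with parameters (a - 1) /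
    c, c, (d - 1) / c. For c = 0, adding the first row to the second gives lower left entry a != 0,
    and a lower unipotent undoes this. *)
Lemma quad_preserving a b c d : a * d - b * c = 1 ->
  integral_preserving mu3 mu3 (quad a b c d).
Proof.
have H (a' b' c' d' : R) : c' != 0 -> a' * d' - b' * c' = 1 ->
    integral_preserving mu3 mu3 (quad a' b' c' d').
  move=> c0 e.
  have := integral_preserving_comp (integral_preserving_comp
    (quad_upper ((d' - 1) / c')) (quad_lower c')) (quad_upper ((a' - 1) / c')).
  congr integral_preserving; apply/funext => P /=; rewrite !quadM.
  have -> : b' = (a' * d' - 1) / c' by rewrite -e; field.
  by congr quad; field.
have [-> e|c0] := eqVneq c 0; last exact: H.
have a0 : a != 0 by apply: contraPneq e => ->; rewrite mul0r mulr0 subr0 => /esym/eqP; rewrite oner_eq0.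
have := integral_preserving_comp (H a b a (b + d) a0 _) (quad_lower (-1)).
rewrite (_ : a * (b + d) - b * a = 1); last by rewrite -e; ring.
move/(_ erefl); congr integral_preserving; apply/funext => P /=; rewrite !quadM.
by congr quad; ring.
Qed.

Definition qdet (P : R * R * R) : R := P.2 * P.1.2 - P.1.1 ^+ 2.

Lemma qdet_quad a b c d P : a * d - b * c = 1 -> qdet (quad a b c d P) = qdet P.
Proof.
move=> e; case: P => [[p q] r]; rewrite /qdet/=.
transitivity ((a * d - b * c) ^+ 2 * (r * q - p ^+ 2)); first by ring.
by rewrite e expr1n mul1r.
Qed.

End SymmetricMatrices.

(** * Radial integrals in the plane *)

Section RadialPushforward.
Variable R : realType.
Local Notation T := (measurableTypeR R).
Local Notation mu := (@lebesgue_measure R).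
Local Notation mu2 := (sprod mu mu).

Lemma measure_unique_rays (m1 m2 : {measure set T -> \bar R}) :
  (forall b : R, m1 `]-oo, b[%classic = m2 `]-oo, b[%classic) ->
  (forall b : R, (m1 `]-oo, b[%classic < +oo)%E) ->
  forall A, measurable A -> m1 A = m2 A.
Proof.
move=> m12 fin A mA.
have H := (@measure_unique _ R T (@RGenInftyO.G R) (fun k => `]-oo, k%:R[%classic) _ _ _ _ m1 m2 _ _ A mA); apply: H => //.
- exact: RGenInftyO.measurableE.
- move=> _ _ [x ->] [y ->]; exists (Num.min x y).
  apply/seteqP; split=> z /=; rewrite !in_itv/= lt_min; first by move=> [-> ->].
  by move=> /andP[].
- by move=> i; exists i%:R.
- apply/seteqP; split=> // z _; exists (Num.truncn `|z|).+1 => //=.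
  by rewrite in_itv/= (le_lt_trans (ler_norm z))// truncnS_gt.
- by move=> _ [x ->].
Qed.

Definition sqn (x : T * T) : T := (x.1 : R) ^+ 2 + (x.2 : R) ^+ 2.

Lemma measurable_sqn : measurable_fun setT sqn.
Proof. by rewrite /sqn; mfun. Qed.

Lemma ge0_integral_scale2 (s : R) (f : T * T -> \bar R) : s != 0 ->
  measurable_fun setT f -> (forall x, (0 <= f x)%E) ->
  (\int[mu2]_x f x = (s ^+ 2)%:E * \int[mu2]_x f (s * (x.1 : R), s * (x.2 : R))%R)%E.
Proof.
move=> s0 mf f0.
have ms : measurable_fun setT (fun x : T * T => (s * (x.1 : R) : T, s * (x.2 : R) : T)).
  by mfun.
have mg := measurableT_comp mf ms.
rewrite [LHS]ge0_integral_sprod1// [in RHS](ge0_integral_sprod1 _ _ mg) => [|x]; last exact: f0.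
rewrite (@ge0_integral_affine _ s 0) => [|//||]; first last.
- by move=> x; apply: integral_ge0 => *; exact: f0.
- exact: measurable_fun_fubini_tonelli_F.
have -> : s ^+ 2 = `|s| * `|s| by rewrite -normrM -expr2 ger0_norm ?sqr_ge0.
rewrite EFinM -muleA; congr (_ * _)%E.
rewrite -ge0_integralZl_EFin//=; first last.
- by apply: (@measurable_fun_fubini_tonelli_F _ _ _ _ R mu _ mg) => x; exact: f0.
- by move=> x _; apply: integral_ge0 => *; exact: f0.
apply: eq_integral => x _ /=; rewrite addr0 (@ge0_integral_affine _ s 0) => [|//||]; first last.
- by move=> y; exact: f0.
- exact: measurableT_comp mf (pair1_measurable _).
by congr (_ * _)%E; apply: eq_integral => y _; rewrite addr0.
Qed.

(** The area of the open unit disc, known here through the squares of half-side 1 around it and 1/2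
    inside it. *)
Let c : R := fine (mu2 (sqn @^-1` `]-oo, 1[%classic)).

Let meas_ray (q : R) : measurable (sqn @^-1` `]-oo, q[%classic).
Proof. by rewrite -[X in measurable X]setTI; apply: measurable_sqn. Qed.

Let square (r : R) : set (T * T) := `[- r, r]%classic `*` `[- r, r]%classic.

Let sprod_square (r : R) : 0 < r ->
  mu2 (square r) = ((r *+ 2) ^+ 2)%:E.
Proof.
move=> r0; rewrite [LHS]product_measure1E//= !lebesgue_measure_itv/= lte_fin.
by rewrite gtrN// -EFinB opprK -EFinM.
Qed.

Let cE : mu2 (sqn @^-1` `]-oo, 1[%classic) = c%:E.
Proof.
rewrite fineK// ge0_fin_numE//.
apply: (@le_lt_trans _ _ (mu2 (square 1))); last by rewrite sprod_square// ltry.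
  apply: le_measure; rewrite ?inE//; first by apply: measurableX.
  move=> [x y]; rewrite /square /sqn /= !in_itv/= => xy.
  by split; apply/andP; split; nra.
Qed.

Let c_gt0 : 0 < c.
Proof.
rewrite -lte_fin -cE.
apply: (@lt_le_trans _ _ (mu2 (square 2^-1))).
  by rewrite sprod_square// lte_fin exprn_gt0// mulrn_wgt0.
apply: le_measure; rewrite ?inE//; first by apply: measurableX.
move=> [x y]; rewrite /square /sqn /= !in_itv/= => -[/andP[? ?] /andP[? ?]]; nra.
Qed.

(** Scaling both coordinates by sqrt q carries the unit disc to the set where [sqn] is below q and
    multiplies areas by q. *)
Let sqn_ray (q : R) : 
  mu2 (sqn @^-1` `]-oo, q[%classic) = (c * Num.max 0 q)%:E.
Proof.
have [q0|q0] := leP q 0.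
  rewrite (_ : _ @^-1` _ = set0) ?measure0 ?mulr0//.
  apply/seteqP; split=> // -[x y] /=; rewrite /sqn in_itv/= => h.
  by have := le_lt_trans (addr_ge0 (sqr_ge0 x) (sqr_ge0 y)) (lt_le_trans h q0); rewrite ltxx.
have s0 : Num.sqrt q != 0 by rewrite gt_eqF// sqrtr_gt0.
have I (r : R) : mu2 (sqn @^-1` `]-oo, r[%classic) = (\int[mu2]_x (\1_(sqn @^-1` `]-oo, r[%classic) x)%:E)%E.
  by rewrite integral_indic ?setIT.
rewrite I (ge0_integral_scale2 s0); last 2 first.
- by apply/measurable_EFinP; exact: measurable_indic.
- by move=> x; rewrite lee_fin.
rewrite sqr_sqrtr ?ltW// EFinM muleC -cE I; congr (_ * _)%E.
apply: eq_integral => -[x y] _; congr (_%:E); rewrite !indicE.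
congr ((_ : bool)%:R); apply/idP/idP; rewrite !inE /sqn /= !in_itv/= !exprMn sqr_sqrtr ?ltW// -mulrDr.
  by rewrite gtr_pMr.
by rewrite gtr_pMr.
Qed.

Let absn (x : T) : T := `|x : R|.

Let abs_ray (q : R) :
  mu (absn @^-1` `]-oo, q[%classic) = (2 * Num.max 0 q)%:E.
Proof.
rewrite (_ : _ @^-1` _ = `]-q, q[%classic); last first.
  by apply/seteqP; split=> x /=; rewrite !in_itv/= ltr_norml.
rewrite lebesgue_measure_itv/= lte_fin.
have [q0|q0] := leP q 0; first by rewrite ifF ?mulr0//; apply/negbTE; lra.
by rewrite gtrN// -EFinB opprK; congr EFin; lra.
Qed.

(** The set where x^2 + y^2 < q has area linear in q, so the squared radius is distributed by a
    multiple of Lebesgue measure on the half-line. That half-line measure is realised on the whole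
    line as half the image of Lebesgue measure under the absolute value, and the two measures are
    compared on rays. *)
Lemma ge0_integral_radial : exists2 c' : R, 0 < c' &
  forall G : R -> \bar R, measurable_fun setT G -> (forall x, (0 <= G x)%E) ->
  (\int[mu2]_x G (sqn x) = c'%:E * \int[mu]_(x in `[0%R, +oo[) G x)%E.
Proof.
exists c => // G mG G0.
have c2 : 0 <= c / 2 by rewrite divr_ge0// ltW.
pose nu1 : {measure set T -> \bar R} :=
  measure_function_pushforward__canonical__measure_function_Measure mu2 measurable_sqn.
have mn : measurable_fun setT absn by exact: normr_measurable.
pose nu2 : {measure set T -> \bar R} :=
  mscale (NngNum c2) (measure_function_pushforward__canonical__measure_function_Measure mu mn).
have E A : measurable A -> nu1 A = nu2 A.
  apply: measure_unique_rays => b.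
    rewrite /nu1 /nu2/= /mscale/= [LHS]sqn_ray [X in (_ * X)%E]abs_ray -EFinM.
    by congr EFin; field.
  by rewrite /nu1 /= /pushforward [X in (X < _)%E]sqn_ray ltry.
transitivity (\int[nu1]_x G x)%E.
  by rewrite [RHS]ge0_integral_pushforward//; exact: measurable_sqn.
rewrite (eq_measure_integral nu2) => [|A mA _]; last exact: E.
rewrite ge0_integral_mscale// ge0_integral_pushforward//=.
have -> : (c%:E = (c / 2)%:E * 2%:E)%E by rewrite -EFinM; congr EFin; field.
rewrite -muleA; congr (_ * _)%E.
rewrite preimage_setT.
have mGn : measurable_fun setT (fun x : R => G `|x|) by exact: measurableT_comp.
rewrite -(setUv `[0%R, +oo[%classic) ge0_integral_setU//; last first.
- by rewrite disj_set2E setICr.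
- by rewrite setUv.
- exact: measurableC.
have -> : 2%:E = (1 + 1)%E :> \bar R by [].
rewrite ge0_muleDl// mul1e; congr (_ + _)%E.
  by apply: eq_integral => x; rewrite inE/= in_itv/= andbT => x0; rewrite /absn ger0_norm.
rewrite setCitvr.
rewrite integral_mkcond.
rewrite (@ge0_integral_affine R (-1) 0) ?oppr_eq0 ?oner_neq0//; last first.
- by move=> x; rewrite /patch; case: ifP.
- by apply/(measurable_restrictT _ _).1 => //; exact: measurable_funTS.
rewrite normrN1 mul1e -[RHS]integral_itv_obnd_cbnd; last exact: measurable_funTS.
rewrite [RHS]integral_mkcond; apply: eq_integral => x _.
rewrite /patch /absn addr0 mulN1r normrN.
have -> : (- x \in `]-oo, 0[%classic) = (x \in `]0, +oo[%classic).
  by rewrite !mem_setE !in_itv/= andbT oppr_lt0.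
case: ifPn => //; rewrite mem_setE in_itv/= andbT => x0.
by rewrite gtr0_norm.
Qed.
End RadialPushforward.

(** * Radial integrals on the cone of positive definite matrices *)

Section ConeIntegral.
Variable R : realType.
Local Notation T := (measurableTypeR R).
Local Notation mu := (@lebesgue_measure R).
Local Notation mu2 := (sprod mu mu).
Local Notation mu3 := (sprod mu2 mu).

Definition cone (P : R * R * R) : bool :=
  [&& 0 < P.2 + P.1.2, 0 < qdet P & qdet P < 1].

(** Half the trace of P after rescaling to determinant 1; it equals |h|^2 / 2 when P is a positive
    multiple of h h^T with det h = 1. *)
Definition coshd (P : R * R * R) : R := (P.2 + P.1.2) / 2 * (Num.sqrt (qdet P))^-1.

Lemma measurable_invsqrt : measurable_fun setT (fun x : T => (Num.sqrt (x : R))^-1 : T).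
Proof.
rewrite (_ : (fun _ => _) = (fun x : R => x `^ (-1)) \o Num.sqrt).
  apply: measurableT_comp; first exact: measurable_powR.
  by apply: continuous_measurable_fun; exact: sqrt_continuous.
by apply/funext => x /=; rewrite powR_inv1// sqrtr_ge0.
Qed.

Lemma measurable_qdet : measurable_fun setT (@qdet R : T * T * T -> T).
Proof. by rewrite /qdet; mfun. Qed.

Lemma measurable_coshd : measurable_fun setT (coshd : T * T * T -> T).
Proof.
apply: measurable_funM; first by mfun.
exact: measurableT_comp measurable_invsqrt measurable_qdet.
Qed.

Lemma measurable_cone : measurable_fun setT (cone : T * T * T -> bool).
Proof.
have := measurable_qdet => mq.
apply: measurable_and; last apply: measurable_and.
- by apply: measurable_fun_ltr; mfun.
- by apply: measurable_fun_ltr; mfun.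
- by apply: measurable_fun_ltr; mfun.
Qed.

(** The weight left on the determinant e: at fixed e the trace is 2 sqrt e times [coshd], and 2 sqrt
    e is the Jacobian. *)
Let g (e : R) : R := if (0 < e) && (e < 1) then 2 * Num.sqrt e else 0.

Let mg : measurable_fun setT g.
Proof.
apply: measurable_fun_ifT.
- by apply: measurable_and; apply: measurable_fun_ltr; mfun.
- apply: measurable_funM => //.
  by apply: continuous_measurable_fun; exact: sqrt_continuous.
- exact: measurable_cst.
Qed.

Let g0 e : 0 <= g e.
Proof. by rewrite /g; case: ifP => // _; rewrite mulr_ge0// sqrtr_ge0. Qed.

(** The weight is at most 2 on ]0, 1[ and at least 1 on ]1/4, 1/2[, so its integral lies between 1/4
    and 2. *)
Lemma integral_sqrt_weight : exists2 c : R, 0 < c & (\int[mu]_e (g e)%:E = c%:E)%E.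
Proof.
have le2 : (\int[mu]_e (g e)%:E <= 2%:E)%E.
  apply: (@le_trans _ _ (\int[mu]_e (2 * \1_`]0, 1[%classic e)%:E)%E).
    apply: ge0_le_integral => //.
    - by move=> x _; rewrite lee_fin.
    - exact/measurable_EFinP.
    - by apply/measurable_EFinP; apply: measurable_funM => //; exact: measurable_indic.
    - move=> e _; rewrite lee_fin /g indicE mem_setE in_itv/=.
      case: ifPn => [/andP[e0 e1]|_]; last by rewrite mulr0.
      by rewrite mulr1 ler_piMr// -sqrtr1 ler_sqrt// ltW.
  under eq_integral do rewrite EFinM.
  rewrite ge0_integralZl_EFin//=; last by apply/measurable_EFinP; exact: measurable_indic.
  by rewrite integral_indic// setIT/= lebesgue_measure_itv/= lte_fin ltr01 -EFinB subr0 mule1.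
have ge2 : ((4^-1)%:E <= \int[mu]_e (g e)%:E)%E.
  apply: (@le_trans _ _ (\int[mu]_e (\1_`]4^-1, 2^-1[%classic e)%:E)%E).
    rewrite integral_indic// setIT/= lebesgue_measure_itv/= lte_fin ifT; last by lra.
    by rewrite -EFinB lee_fin; lra.
  apply: ge0_le_integral => //.
  - by apply/measurable_EFinP; exact: measurable_indic.
  - exact/measurable_EFinP.
  - move=> e _; rewrite lee_fin indicE mem_setE in_itv/=.
    have [/andP[e0 e1]|_] := boolP ((4^-1 < e) && (e < 2^-1)); last exact: g0.
    rewrite /g ifT; last by apply/andP; split; lra.
    have : Num.sqrt (2^-1 ^+ 2) <= Num.sqrt e by rewrite ler_sqrt; nra.
    by rewrite sqrtr_sqr ger0_norm// mulr1n => ?; lra.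
exists (fine (\int[mu]_e (g e)%:E)%E).
  by rewrite fine_gt0// (lt_le_trans _ ge2)//= (le_lt_trans le2)// ltry.
rewrite fineK// ge0_fin_numE ?(le_lt_trans le2) ?ltry//.
by apply: integral_ge0 => x _; rewrite lee_fin.
Qed.

(** Coordinates in which p is the trace and the determinant is p^2 / 4 minus the squared radius of
    the first two; the change of coordinates is a composite of shears and swaps. *)
Let phi (P : T * T * T) : T * T * T :=
  ((P.1.1 : T, (P.1.2 : R) - ((P.2 : R) + P.1.2) / 2), (P.2 : R) + P.1.2).

Let phi_preserving : integral_preserving mu3 mu3 phi.
Proof.
have m1 : measurable_fun setT (fun q : T * T => (q.2 : T)) by mfun.
have m2 : measurable_fun setT (fun q : T * T => - ((q.2 : R) / 2) : T) by mfun.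
have := integral_preserving_comp (integral_preserving_comp
  (integral_preserving_comp (integral_preserving_shear mu2 m1) (integral_preserving_swap12 mu mu mu))
  (integral_preserving_shear mu2 m2)) (integral_preserving_swap12 mu mu mu).
by congr integral_preserving; apply/funext => -[[p q] r].
Qed.

Variable K : R -> \bar R.
Hypothesis mK : measurable_fun setT K.
Hypothesis K0 : forall x, (0 <= K x)%E.

(** The integrand in terms of the trace p and the squared radius q. In [chi2] the determinant e =
    p^2 / 4 - q replaces q, and q >= 0 becomes 4 e <= p^2. *)
Let chi (p q : R) : \bar R :=
  let e := p ^+ 2 / 4 - q in
  if [&& 0 < p, 0 < e & e < 1] then K (p / 2 * (Num.sqrt e)^-1) else 0%E.

Let chi2 (e p : R) : \bar R :=
  if [&& 0 < p, 0 < e, e < 1 & 4 * e <= p ^+ 2] then K (p / 2 * (Num.sqrt e)^-1) else 0%E.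

Let chi_ge0 p q : (0 <= chi p q)%E.
Proof. by rewrite /chi; case: ifP. Qed.

Let chi2_ge0 p q : (0 <= chi2 p q)%E.
Proof. by rewrite /chi2; case: ifP. Qed.

Let mchi : measurable_fun setT (fun x : T * T => chi x.1 x.2).
Proof.
have me : measurable_fun setT (fun x : T * T => (x.1 : R) ^+ 2 / 4 - (x.2 : R) : T) by mfun.
apply: measurable_fun_ifT.
- apply: measurable_and; last apply: measurable_and;
    by apply: measurable_fun_ltr; mfun.
- apply: measurableT_comp => //; apply: measurable_funM; first by mfun.
  exact: measurableT_comp measurable_invsqrt me.
- exact: measurable_cst.
Qed.

Let mchi2 : measurable_fun setT (fun x : T * T => chi2 x.1 x.2).
Proof.
apply: measurable_fun_ifT.
- apply: measurable_and; first by apply: measurable_fun_ltr; mfun.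
  apply: measurable_and; first by apply: measurable_fun_ltr; mfun.
  apply: measurable_and; first by apply: measurable_fun_ltr; mfun.
  by apply: measurable_fun_ler; mfun.
- apply: measurableT_comp => //; apply: measurable_funM; first by mfun.
  exact: measurableT_comp measurable_invsqrt measurable_fst.
- exact: measurable_cst.
Qed.

Let J : \bar R := (\int[mu]_(x in `[1%R, +oo[) K x)%E.

(** Under p = 2 sqrt e x the argument of [K] becomes x and the condition 4 e <= p^2 becomes x >= 1,
    which separates e from x. *)
Let int_chi2 e : (\int[mu]_p chi2 e p = (g e)%:E * J)%E.
Proof.
rewrite /g; case: ifPn => [/andP[e0 e1]|e01]; last first.
  rewrite mul0e integral0_eq// => p _; rewrite /chi2 ifF//.
  by apply: contraNF e01 => /and4P[_ -> ->].
have s0 : 0 < Num.sqrt e by rewrite sqrtr_gt0.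
rewrite (@ge0_integral_affine _ (2 * Num.sqrt e) 0); last 3 first.
- by rewrite gt_eqF// mulr_gt0.
- exact: measurableT_comp mchi2 (pair1_measurable e).
- exact: chi2_ge0.
rewrite ger0_norm ?mulr_ge0 ?(ltW s0)//; congr (_ * _)%E.
rewrite /J [RHS]integral_mkcond; apply: eq_integral => x _.
rewrite /chi2 /patch addr0 mem_setE in_itv/= andbT pmulr_rgt0 ?mulr_gt0// e0 e1/=.
have -> : 2 * Num.sqrt e * x / 2 * (Num.sqrt e)^-1 = x by field; rewrite gt_eqF.
rewrite !exprMn sqr_sqrtr ?(ltW e0)// (_ : 2 ^+ 2 = 4 :> R); last by ring.
rewrite ler_pMr ?mulr_gt0//; congr (if _ then _ else _).
apply/andP/idP => [[x0 x1]|x1].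
  by rewrite -(@ler_pXn2r _ 2) ?nnegrE ?ler01 ?(ltW x0) // expr1n.
by split; [exact: lt_le_trans x1|rewrite exprn_ege1].
Qed.

Let int_chi p : (\int[mu]_(q in `[0%R, +oo[) chi p q = \int[mu]_e chi2 e p)%E.
Proof.
rewrite integral_mkcond [LHS](@ge0_integral_affine _ (-1) (p ^+ 2 / 4)); last 3 first.
- by rewrite oppr_eq0 oner_eq0.
- have mc : measurable_fun (`[0%R, +oo[%classic : set T) (chi p) by apply: measurable_funTS; exact: measurableT_comp mchi (pair1_measurable p).
  by apply: (iffLR (measurable_restrictT _ _) mc); exact: measurable_itv.
- by move=> x; rewrite /patch; case: ifP.
rewrite normrN1 mul1e; apply: eq_integral => e _.
rewrite /patch /chi /chi2 mem_setE in_itv/= andbT.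
rewrite (_ : p ^+ 2 / 4 - _ = e); last by ring.
have -> : (0 <= -1 * e + p ^+ 2 / 4) = (4 * e <= p ^+ 2).
  by apply/idP/idP => ?; lra.
by case: (4 * e <= _); rewrite ?andbT ?andbF//.
Qed.

(** At fixed trace the integral over the plane is radial; the squared radius is traded for the
    determinant, and exchanging determinant and trace lets [int_chi2] factor the integral. *)
Lemma ge0_integral_cone_aux (c1 c2 : R) :
  (forall G : R -> \bar R, measurable_fun setT G -> (forall x, (0 <= G x)%E) ->
  (\int[mu2]_x G (sqn x) = c1%:E * \int[mu]_(x in `[0%R, +oo[) G x)%E) ->
  (\int[mu]_e (g e)%:E = c2%:E)%E -> 0 <= c1 ->
  (\int[mu3]_P (if cone P then K (coshd P) else 0) = (c1 * c2)%:E * J)%E.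
Proof.
move=> radial intg c10.
have J0 : (0 <= J)%E by exact: integral_ge0.
have [mphi ephi] := phi_preserving.
pose psi (P : T * T * T) : \bar R := chi P.2 (sqn P.1).
have mpsi : measurable_fun setT psi.
  have mh : measurable_fun setT (fun P : T * T * T => (P.2, sqn P.1)).
    apply: measurable_fun_pair; first exact: measurable_snd.
    exact: measurableT_comp (@measurable_sqn R) measurable_fst.
  exact: measurableT_comp mchi mh.
have psi0 P : (0 <= psi P)%E by exact: chi_ge0.
transitivity (\int[mu3]_P psi (phi P))%E.
  apply: eq_integral => -[[b d] a] _.
  rewrite /psi /phi /chi /sqn /cone /coshd /=.
  have -> : (a + d) ^+ 2 / 4 - (b ^+ 2 + (d - (a + d) / 2) ^+ 2) = qdet (b, d, a).
    by rewrite /qdet/=; field.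
  by [].
rewrite ephi// ge0_integral_sprod2//.
transitivity (\int[mu]_p (c1%:E * \int[mu]_e chi2 e p))%E.
  apply: eq_integral => p _; rewrite -int_chi /psi/= radial//.
  exact: measurableT_comp mchi (pair1_measurable p).
have mswap := measurableT_comp mchi2 (@measurable_swap_prod _ _ T T).
rewrite ge0_integralZl_EFin//=; last 2 first.
- by move=> p _; exact: integral_ge0.
- by apply: (@measurable_fun_fubini_tonelli_F _ _ _ _ R mu _ mswap) => x; exact: chi2_ge0.
rewrite EFinM -muleA; congr (_ * _)%E.
rewrite (fubini_tonelli (m1 := mu) (m2 := mu) (fun x => chi2 x.2 x.1) mswap)//=.
under eq_integral do rewrite int_chi2.
rewrite ge0_integralZr// ?intg//.
  exact/measurable_EFinP.
by move=> e _; rewrite lee_fin.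
Qed.

End ConeIntegral.

Lemma ge0_integral_cone (R : realType) (mu := @lebesgue_measure R) :
  exists2 c : R, 0 < c & forall K : R -> \bar R,
    measurable_fun setT K -> (forall x, (0 <= K x)%E) ->
  (\int[sprod (sprod mu mu) mu]_P (if cone P then K (coshd P) else 0)
   = c%:E * \int[mu]_(x in `[1%R, +oo[) K x)%E.
Proof.
have [c1 c10 radial] := ge0_integral_radial R.
have [c2 c20 intg] := integral_sqrt_weight R.
exists (c1 * c2); first exact: mulr_gt0.
by move=> K mK K0; apply: ge0_integral_cone_aux => //; exact: ltW.
Qed.

(** * Beta integrals *)

Section BetaTail.
Variable R : realType.
Local Notation mu := (@lebesgue_measure R).
Implicit Types a b x r s c : R.

Lemma continuous_powRl (p x : R) : 0 < x -> {for x, continuous (fun y : R => y `^ p)}.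
Proof.
move=> x0; apply: differentiable_continuous; apply/derivable1_diffP.
by apply: derivable_powR; rewrite in_itv/= x0.
Qed.

Lemma derivable_onem_powR (p x : R) : x < 1 -> is_derive x 1 (fun y : R => (1 - y) `^ p) (- (p * (1 - x) `^ (p - 1))).
Proof.
move=> x1.
have d1 : is_derive x 1 (fun y : R => 1 - y) (-1).
  have := is_deriveB (is_derive_cst (1 : R) x 1) (is_derive_id x (1 : R)).
  by rewrite sub0r.
have x0 : 0 < 1 - x by rewrite subr_gt0.
have d2 := is_derive1_powR p x0.
have := @is_derive1_comp R (fun y => y `^ p) (fun y => 1 - y) x _ _ d2 d1.
by rewrite mulrN1.
Qed.

Lemma continuous_onem_powR (p x : R) : x < 1 -> {for x, continuous (fun y : R => (1 - y) `^ p)}.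
Proof.
move=> x1; apply: differentiable_continuous; apply/derivable1_diffP.
by have [] := derivable_onem_powR p x1.
Qed.

Lemma continuous_beta_weight a b x : 0 < x < 1 -> {for x, continuous (beta_weight a b)}.
Proof.
move=> /andP[x0 x1]; apply: (@continuousM R R).
  exact: continuous_powRl.
exact: continuous_onem_powR.
Qed.

Lemma beta_weight_ge0 a b x : 0 <= beta_weight a b x.
Proof. by rewrite mulr_ge0 ?powR_ge0. Qed.

Lemma measurable_beta_weight a b : measurable_fun setT (beta_weight a b).
Proof.
apply: measurable_funM; first exact: measurable_powR.
apply: (measurableT_comp (measurable_powR _)).
by apply: measurable_funB => //.
Qed.

(** This is (c - 1) / (c + 1), the squared modulus of (z - i) / (z + i) when c is cosh of the
    distance from i to z. *)
Definition cosh_rad (c : R) : R := 1 - 2 * (c + 1)^-1.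
(** The exponent is b + 1 because the derivative of x = [cosh_rad c] is (1 - x)^2 / 2, which raises
    b - 1 by two. *)
Definition cosh_density a b c : R := cosh_rad c `^ (a - 1) * (1 - cosh_rad c) `^ (b + 1).

Lemma is_derive_cosh_rad c : -1 < c ->
  is_derive c 1 cosh_rad (2 * (c + 1) ^- 2).
Proof.
move=> c1; have c0 : c + 1 != 0 by rewrite gt_eqF//; lra.
have d1 : is_derive c 1 (fun y : R => y + 1) 1.
  have := is_deriveD (is_derive_id c (1 : R)) (is_derive_cst (1 : R) c 1).
  by rewrite addr0.
have d2 := @is_deriveV R (fun y => y + 1) c 1 1 c0 d1.
have := is_deriveB (is_derive_cst (1 : R) c 1) (is_deriveZ 2 d2).
rewrite sub0r scaleNr scalerN opprK.
rewrite (_ : 2 *: ((c + 1) ^- 2 *: 1) = 2 * (c + 1) ^- 2)//.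
by rewrite -[RHS]/(2 *: _) -[in RHS](mulr1 (_ ^- 2)).
Qed.

Lemma cosh_rad_derive1 c : -1 < c -> (cosh_rad^`())%classic c = 2 * (c + 1) ^- 2.
Proof. by move=> c1; rewrite derive1E; have [_ ->] := is_derive_cosh_rad c1. Qed.

Lemma continuous_cosh_rad_derive1 c : -1 < c -> {for c, continuous (cosh_rad^`())%classic}.
Proof.
move=> c1.
have E : \forall y \near c, 2 * (y + 1) ^- 2 = (cosh_rad^`())%classic y.
  by near=> y; rewrite cosh_rad_derive1//; near: y; exact: lt_nbhsr.
rewrite /prop_for /continuous_at cosh_rad_derive1//.
apply: cvg_trans (near_eq_cvg E) _.
have c0 : (c + 1) ^+ 2 != 0 by rewrite expf_eq0/= gt_eqF//; lra.
apply: cvgM; first exact: cvg_cst.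
apply: cvgV => //.
apply: (@continuous_comp R R R (fun y => y + 1) (fun y => y ^+ 2)); last exact: exprn_continuous.
by apply: cvgD; [exact: cvg_id|exact: cvg_cst].
Unshelve. all: by end_near. Qed.

Lemma continuous_cosh_rad c : -1 < c -> {for c, continuous cosh_rad}.
Proof.
move=> c1; apply: differentiable_continuous; apply/derivable1_diffP.
by have [] := is_derive_cosh_rad c1.
Qed.

Lemma cosh_rad_lt c d : -1 < c -> c < d -> cosh_rad c < cosh_rad d.
Proof.
move=> c1 cd; rewrite /cosh_rad ltrD2l ltrN2 ltr_pM2l// ltf_pV2 ?posrE; lra.
Qed.

Definition rad_cosh (r : R) : R := (1 + r) / (1 - r).

Lemma rad_coshK r : r < 1 -> cosh_rad (rad_cosh r) = r.
Proof.
by move=> r1; rewrite /cosh_rad /rad_cosh; field; rewrite !gt_eqF//=; lra.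
Qed.

Lemma rad_cosh_ge1 r : 0 <= r -> r < 1 -> 1 <= rad_cosh r.
Proof. by move=> r0 r1; rewrite /rad_cosh ler_pdivlMr ?subr_gt0//; lra. Qed.

Lemma rad_cosh_lt r s : r < s -> s < 1 -> rad_cosh r < rad_cosh s.
Proof.
move=> rs s1; have s0 : 0 < 1 - s by rewrite subr_gt0.
rewrite /rad_cosh ltr_pdivrMr; last by lra.
rewrite mulrAC ltr_pdivlMr//; nra.
Qed.

Lemma onem_cosh_rad c : 1 - cosh_rad c = 2 * (c + 1)^-1.
Proof. by rewrite /cosh_rad opprB addrC subrK. Qed.

(** Both 0 and 1 are kept out of the segment: the weight is continuous strictly between them. *)
Lemma integral_beta_weight_segment a b r s : 0 < r -> r < s -> s < 1 ->
  (\int[mu]_(x in `[r, s]) (beta_weight a b x)%:E =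
   \int[mu]_(c in `[rad_cosh r, rad_cosh s]) (2^-1 * cosh_density a b c)%:E)%E.
Proof.
move=> r0 rs s1.
have r1 := lt_trans rs s1.
have C1 c : rad_cosh r <= c -> -1 < c.
  by have := rad_cosh_ge1 (ltW r0) r1; lra.
have rs' := rad_cosh_lt rs s1.
rewrite -{1}(rad_coshK r1) -{1}(rad_coshK s1).
rewrite integration_by_substitution_increasing ?(ltW rs')//; first last.
- rewrite !rad_coshK//; apply: continuous_in_subspaceT => x.
  rewrite inE/= in_itv/= => /andP[rx xs]; apply: continuous_beta_weight.
  by apply/andP; split; lra.
- split.
  + move=> c; rewrite in_itv/= => /andP[/ltW/C1 c1 _].
    by have [] := is_derive_cosh_rad c1.
  + by apply: cvg_at_right_filter; apply: continuous_cosh_rad; exact: C1.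
  + by apply: cvg_at_left_filter; apply: continuous_cosh_rad; apply: C1; exact: ltW.
- apply/cvg_ex; eexists; apply: cvg_at_left_filter.
  by apply: continuous_cosh_rad_derive1; apply: C1; exact: ltW.
- apply/cvg_ex; eexists; apply: cvg_at_right_filter.
  by apply: continuous_cosh_rad_derive1; exact: C1.
- move=> c; rewrite in_itv/= => /andP[/ltW/C1 c1 _].
  exact: continuous_cosh_rad_derive1.
- move=> c d; rewrite !in_itv/= => /andP[/C1 c1 _] _ cd.
  exact: cosh_rad_lt.
apply: eq_integral => c; rewrite inE/= in_itv/= => /andP[/C1 c1 _]; congr EFin.
rewrite !fctE /= cosh_rad_derive1// /beta_weight /cosh_density -mulrA [RHS]mulrCA; congr (_ * _).
have c0 : 0 < 2 * (c + 1)^-1 by rewrite mulr_gt0 ?invr_gt0//; lra.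
rewrite onem_cosh_rad.
have -> : b + 1 = (b - 1) + 2%:R by ring.
rewrite (@powRD _ _ (b - 1)) ?(gt_eqF c0) ?implybT// (powR_mulrn 2) ?(ltW c0)//.
by rewrite [RHS]mulrCA; congr (_ * _); field; rewrite gt_eqF//; lra.
Qed.
Lemma measurable_invr : measurable_fun setT (fun x : R => x^-1).
Proof.
rewrite (_ : (fun _ => _) = fun x : R => x * (x ^+ 2) `^ (-1)).
  apply: measurable_funM => //.
  exact: measurableT_comp (measurable_powR _) (exprn_measurable _).
apply/funext => x; rewrite powR_inv1 ?sqr_ge0//.
by have [->|x0] := eqVneq x 0; [rewrite invr0 mul0r|field].
Qed.

Lemma measurable_cosh_density a b : measurable_fun setT (cosh_density a b).
Proof.
have mr : measurable_fun setT cosh_rad.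
  apply: measurable_funB => //; apply: measurable_funM => //.
  by apply: (measurableT_comp measurable_invr); exact: measurable_funD.
apply: measurable_funM; first exact: measurableT_comp (measurable_powR _) mr.
apply: (measurableT_comp (measurable_powR _)).
by apply: measurable_funB => //.
Qed.

Lemma cosh_density_ge0 a b c : 0 <= cosh_density a b c.
Proof. by rewrite mulr_ge0 ?powR_ge0. Qed.

Lemma cosh_radK c : -1 < c -> rad_cosh (cosh_rad c) = c.
Proof. by move=> c1; rewrite /cosh_rad /rad_cosh; field; apply/andP; split; rewrite gt_eqF//; lra. Qed.

Lemma rad_cosh_le r s : r <= s -> s < 1 -> rad_cosh r <= rad_cosh s.
Proof. by rewrite le_eqVlt => /predU1P[->//|rs s1]; exact/ltW/rad_cosh_lt. Qed.

(** Monotone convergence along segments inside ]r, 1[ and along their images, which exhaust the open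
    half-line beyond [rad_cosh r]. *)
Lemma integral_beta_weight_tail a b r : 0 <= r -> r < 1 ->
  (\int[mu]_(x in `[r, 1%R]) (beta_weight a b x)%:E =
   \int[mu]_(c in `[rad_cosh r, +oo[) (2^-1 * cosh_density a b c)%:E)%E.
Proof.
move=> r0 r1.
(* Starting the denominators at 3 gives 2 e n < 1 - r, so every segment [r + e n, 1 - e n] is
   nondegenerate. *)
pose e n : R := (1 - r) / (n.+3)%:R.
have e0 n : 0 < e n by rewrite divr_gt0// subr_gt0.
have elt n : 2 * e n < 1 - r.
  rewrite /e mulrA ltr_pdivrMr// mulrC ltr_pM2l ?subr_gt0//.
  by rewrite ltr_nat.
have ele m n : (m <= n)%N -> e n <= e m.
  by move=> mn; rewrite /e ler_pM2l ?subr_gt0// lef_pV2 ?posrE// ler_nat.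
pose F n : set R := `[r + e n, 1 - e n]%classic.
pose F' n : set R := `[rad_cosh (r + e n), rad_cosh (1 - e n)]%classic.
have FT : \bigcup_n F n = `]r, 1[%classic.
  apply/seteqP; split=> x.
    move=> [n _]; rewrite /F/= !in_itv/= => /andP[h1 h2].
    by have := e0 n => ?; apply/andP; split; lra.
  rewrite /= in_itv/= => /andP[rx x1].
  have d0 : 0 < Num.min (x - r) (1 - x) by rewrite lt_min !subr_gt0 rx.
  exists (Num.truncn ((1 - r) / Num.min (x - r) (1 - x))) => //.
  have : e (Num.truncn ((1 - r) / Num.min (x - r) (1 - x))) <= Num.min (x - r) (1 - x).
    rewrite /e ler_pdivrMr// mulrC -ler_pdivrMr//; apply/ltW/(lt_le_trans (truncnS_gt _)).
    by rewrite ler_nat ltnW.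
  by rewrite le_min /F/= in_itv/= => /andP[? ?]; apply/andP; split; lra.
have Cr := rad_cosh_ge1 r0 r1.
have F'T : \bigcup_n F' n = `]rad_cosh r, +oo[%classic.
  apply/seteqP; split=> c.
    move=> [n _]; rewrite /F'/= !in_itv/= andbT => /andP[h1 h2].
    by apply: lt_le_trans h1; have := (e0 n, elt n); case=> ? ?; apply: rad_cosh_lt; lra.
  rewrite /= in_itv/= andbT => rc; have c1 : -1 < c by lra.
  have : `]r, 1[%classic (cosh_rad c).
    rewrite /= in_itv/= -{1}(rad_coshK r1) cosh_rad_lt//=; last by lra.
    by rewrite -subr_gt0 onem_cosh_rad mulr_gt0// invr_gt0; lra.
  rewrite -FT => -[n _]; rewrite /F/= in_itv/= => /andP[h1 h2].
  exists n => //; rewrite /F'/= in_itv/= -(cosh_radK c1).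
  have := e0 n => ?.
  by rewrite !rad_cosh_le//; lra.
have ndF : nondecreasing_seq F.
  move=> m n mn; apply/subsetPset => x; rewrite /F/= !in_itv/= => /andP[h1 h2].
  by have := ele _ _ mn => ?; apply/andP; split; lra.
have ndF' : nondecreasing_seq F'.
  move=> m n mn; apply/subsetPset => x; rewrite /F'/= !in_itv/= => /andP[h1 h2].
  have := (ele _ _ mn, e0 m, e0 n, elt m, elt n) => -[[[[? ?] ?] ?] ?].
  apply/andP; split.
    by apply: le_trans h1; apply: rad_cosh_le; lra.
  by apply: le_trans h2 _; apply: rad_cosh_le; lra.
have mw : measurable_fun setT (EFin \o beta_weight a b).
  by apply/measurable_EFinP; exact: measurable_beta_weight.
have mH : measurable_fun setT (fun c => (2^-1 * cosh_density a b c)%:E).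
  apply/measurable_EFinP; apply: measurable_funM => //; exact: measurable_cosh_density.
rewrite integral_itv_bndoo; last by apply: measurable_funTS.
rewrite -integral_itv_obnd_cbnd; last by apply: measurable_funTS.
rewrite -FT -F'T.
have mF n : measurable (F n) by exact: measurable_itv.
have mF' n : measurable (F' n) by exact: measurable_itv.
have L1 : (\int[mu]_(x in F n) (beta_weight a b x)%:E @[n --> \oo] -->
    \int[mu]_(x in \bigcup_n F n) (beta_weight a b x)%:E)%E.
  apply: ge0_nondecreasing_set_cvg_integral => // [n|n x _].
    exact: measurable_funTS.
  by rewrite lee_fin beta_weight_ge0.
have L2 : (\int[mu]_(c in F' n) (2^-1 * cosh_density a b c)%:E @[n --> \oo] -->
    \int[mu]_(c in \bigcup_n F' n) (2^-1 * cosh_density a b c)%:E)%E.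
  apply: ge0_nondecreasing_set_cvg_integral => // [n|n x _].
    exact: measurable_funTS.
  by rewrite lee_fin mulr_ge0// cosh_density_ge0.
rewrite -(cvg_lim _ L1)// -(cvg_lim _ L2)//.
congr (limn _); apply/funext => n; apply: integral_beta_weight_segment.
- by have := e0 n; lra.
- by have := elt n; lra.
- by have := e0 n; lra.
Qed.
End BetaTail.

(** * Existence of the beta median and the mass beyond it *)

Section BetaMedian.
Variable R : realType.
Local Notation mu := (@lebesgue_measure R).
Variables a b : R.
Hypotheses (a1 : 1 <= a) (b0 : 0 < b).
Local Notation w := (beta_weight a b).
Implicit Types r s x : R.

Let mw (D : set R) : measurable_fun D (EFin \o w).
Proof. by apply: measurable_funTS; apply/measurable_EFinP; exact: measurable_beta_weight. Qed.

Lemma integral_beta_weight_gt0 r s : 0 <= r -> r < s -> s <= 1 ->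
  (0 < \int[mu]_(x in `[r, s]) (w x)%:E)%E.
Proof.
move=> r0 rs s1.
(* The middle third stays away from 0 and 1, and the weight has a positive lower bound there. *)
pose r' := r + (s - r) / 3; pose s' := r + 2 * (s - r) / 3.
have [rr' r's' s's] : [/\ r < r', r' < s' & s' < s] by rewrite /r' /s'; split; lra.
clearbody r' s'.
pose k := r' `^ (a - 1) * (1 - s') `^ b.
have k0 : 0 < k by rewrite mulr_gt0// powR_gt0; lra.
apply: (@lt_le_trans _ _ (\int[mu]_(x in `[r', s']) k%:E)%E).
  rewrite integral_cst//= lebesgue_measure_itv/= lte_fin r's' -EFinB -EFinM lte_fin.
  by rewrite mulr_gt0// subr_gt0.
apply: (@le_trans _ _ (\int[mu]_(x in `[r', s']) (w x)%:E)%E).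
  apply: ge0_le_integral => //=; [by move=> *; rewrite lee_fin ltW|exact: mw|].
  move=> x; rewrite /= in_itv/=; move: (x : R) => {}x /andP[rx xs].
  rewrite lee_fin ler_pM ?powR_ge0//.
    by apply: ge0_ler_powR; rewrite ?nnegrE ?subr_ge0//; lra.
  have x1 : 0 < 1 - x by lra.
  (* The exponent b - 1 may be negative; as 0 < 1 - x <= 1, passing to b > 0 lowers the value and
     makes the power monotone. *)
  apply: (@le_trans _ _ ((1 - x) `^ b)).
    by apply: ge0_ler_powR; rewrite ?nnegrE; try exact: ltW; lra.
  rewrite -[leLHS](@mulr_powRB1 _ _ _ (ltW x1) b0) ler_piMl ?powR_ge0//; lra.
apply: ge0_subset_integral => //=; first exact: mw.
  by move=> x _; rewrite lee_fin beta_weight_ge0.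
by apply: subset_itv; rewrite bnd_simp; lra.
Qed.

(** As a >= 1, the factor x^(a - 1) is at most 1, and (1 - x)^(b - 1) has antiderivative -(1 - x)^b
    / b. The bound is uniform in s, which yields finiteness up to 1. *)
Lemma integral_beta_weight_le s : 0 < s -> s < 1 ->
  (\int[mu]_(x in `[0%R, s]) (w x)%:E <= b^-1%:E)%E.
Proof.
move=> s0 s1.
have bN0 : b != 0 by rewrite gt_eqF.
apply: (@le_trans _ _ (\int[mu]_(x in `[0%R, s]) ((1 - x) `^ (b - 1))%:E)%E).
  apply: ge0_le_integral => //=.
  - by move=> x _; rewrite lee_fin beta_weight_ge0.
  - exact: mw.
  - apply: measurable_funTS; apply/measurable_EFinP.
    by apply: (measurableT_comp (measurable_powR _)); exact: measurable_funB.
  - move=> x; rewrite /= in_itv/=; move: (x : R) => {}x /andP[x0 xs]; rewrite lee_fin ler_piMl ?powR_ge0//.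
    apply: (@le_trans _ _ (1 `^ (a - 1))); last by rewrite powR1.
    apply: ge0_ler_powR; rewrite ?nnegrE ?subr_ge0//; lra.
pose F x : R := (- b^-1) * (1 - x) `^ b.
have dF x : x < 1 -> is_derive x 1 F ((1 - x) `^ (b - 1)).
  move=> x1; have := is_deriveZ (- b^-1) (derivable_onem_powR b x1).
  rewrite (_ : _ *: _ = (1 - x) `^ (b - 1))//.
  by rewrite -[LHS]/(_ * _) mulrN mulNr opprK mulKf.
have cF x : x < 1 -> {for x, continuous F}.
  by move=> x1; apply: differentiable_continuous; apply/derivable1_diffP; have [] := dF x x1.
rewrite (@continuous_FTC2 _ _ F)//.
- rewrite -EFinB lee_fin /F subr0 powR1 mulr1 opprK mulNr addrC lerBlDr lerDl.
  by rewrite mulr_ge0 ?powR_ge0// invr_ge0 ltW.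
- apply: continuous_in_subspaceT => x; rewrite inE/= in_itv/= => /andP[_ xs].
  by apply: continuous_onem_powR; lra.
- split.
  + by move=> x; rewrite in_itv/= => /andP[_ xs]; have [] := dF x (lt_trans xs s1).
  + by apply: cvg_at_right_filter; exact: cF.
  + by apply: cvg_at_left_filter; exact: cF.
- move=> x; rewrite in_itv/= => /andP[_ xs].
  by rewrite derive1E; have [_ ->] := dF x (lt_trans xs s1).
Qed.

Lemma integral_beta_weight_fin : (\int[mu]_(x in `[0%R, 1%R]) (w x)%:E < +oo)%E.
Proof.
rewrite -integral_itv_bndo_bndc; last exact: mw.
pose s n : R := 1 - n.+2%:R^-1.
have s0 n : 0 < s n by rewrite subr_gt0 invf_lt1// ltr1n.
have s1 n : s n < 1 by rewrite ltrBlDr ltrDl invr_gt0.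
pose F n : set R := `[0, s n]%classic.
have FT : `[0, 1[%classic = \bigcup_n F n.
  apply/seteqP; split=> x; last first.
    move=> [n _]; rewrite /F/= !in_itv/= => /andP[-> /=]; have := s1 n; lra.
  rewrite /= in_itv/= => /andP[x0 x1].
  exists (Num.truncn (1 - x)^-1) => //; rewrite /F/= in_itv/= x0/=.
  rewrite /s lerBrDr -lerBrDl -[leRHS]invrK lef_pV2 ?posrE ?invr_gt0 ?subr_gt0//.
  by apply/ltW/(lt_le_trans (truncnS_gt _)); rewrite ler_nat.
have ndF : nondecreasing_seq F.
  move=> m n mn; apply/subsetPset => x; rewrite /F/= !in_itv/= => /andP[-> /= h].
  by rewrite (le_trans h)// lerD2l lerN2 lef_pV2 ?posrE// ler_nat.
have L : (\int[mu]_(x in F n) (w x)%:E @[n --> \oo] -->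
    \int[mu]_(x in \bigcup_n F n) (w x)%:E)%E.
  apply: ge0_nondecreasing_set_cvg_integral => // [n|n|n x _].
  - exact: measurable_itv.
  - exact: mw.
  - by rewrite lee_fin beta_weight_ge0.
rewrite FT -(cvg_lim _ L)//; apply: (@le_lt_trans _ _ b^-1%:E); last exact: ltry.
apply: lime_le; first by apply/cvg_ex; eexists; exact: L.
by apply: nearW => n; exact: integral_beta_weight_le.
Qed.

Lemma integral_beta_weight_split r s x : r <= x -> x <= s ->
  (\int[mu]_(x in `[r, s]) (w x)%:E =
   \int[mu]_(x in `[r, x]) (w x)%:E + \int[mu]_(x in `[x, s]) (w x)%:E)%E.
Proof.
move=> rx xs; rewrite (@itv_bndbnd_setU _ _ _ (BRight x)) ?bnd_simp//.
rewrite ge0_integral_setU//=; first last.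
- apply/disj_set2P; rewrite -subset0 => z/=; rewrite !in_itv/= => -[/andP[_]].
  by rewrite leNgt => /negbTE ->.
- by move=> z _; rewrite lee_fin beta_weight_ge0.
- exact: mw.
by rewrite integral_itv_obnd_cbnd//; exact: mw.
Qed.

(** The intermediate value theorem, applied to the integral from 0 to x, reaches half of the total
    mass; the endpoints are excluded since a point has mass 0. *)
Lemma beta_medianP : is_beta_median a b (beta_median a b).
Proof.
apply: xgetPex.
have W0 := integral_beta_weight_gt0 (lexx 0) ltr01 (lexx 1).
have Woo := integral_beta_weight_fin.
have intw : mu.-integrable `[0, 1] (EFin \o w).
  apply/integrableP; split; first exact: mw.
  under eq_integral do rewrite gee0_abs ?lee_fin ?beta_weight_ge0//.
  exact: Woo.
have cW := parameterized_integral_continuous ler01 intw.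
pose W := (\int[mu]_(x in `[0, 1]) w x)%R.
have WE : (\int[mu]_(x in `[0%R, 1%R]) (w x)%:E = W%:E)%E.
  by rewrite /W /Rintegral fineK// ge0_fin_numE// ltW.
have W_gt0 : 0 < W by rewrite -lte_fin -WE.
have [|x] := IVT ler01 cW (v := W / 2).
  rewrite /parameterized_integral set_itv1 Rintegral_set1 -/W.
  by rewrite min_l ?max_r; lra.
rewrite in_itv/= => /andP[x0 x1] Wx.
have split := integral_beta_weight_split x0 x1.
have Ax : (\int[mu]_(x in `[0%R, x]) (w x)%:E = (W / 2)%:E)%E.
  rewrite -Wx /parameterized_integral /Rintegral fineK// ge0_fin_numE//.
    apply: le_lt_trans Woo; rewrite split leeDl//.
    by apply: integral_ge0 => y _; rewrite lee_fin beta_weight_ge0.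
  by apply: integral_ge0 => y _; rewrite lee_fin beta_weight_ge0.
have Bx : (\int[mu]_(x in `[x, 1%R]) (w x)%:E = (W / 2)%:E)%E.
  move: split; rewrite Ax WE; case: (\int[mu]_(x in `[x, 1%R]) _)%E => [z| |]//.
  by rewrite -EFinD => -[Wz]; congr EFin; lra.
exists x; split; last by rewrite Ax Bx.
have Wh : 0 < W / 2 by rewrite divr_gt0.
apply/andP; split; rewrite lt_neqAle ?x0 ?x1 andbT.
  by apply: contraPneq Ax => <-; rewrite set_itv1 integral_set1 => -[/esym/eqP]; rewrite gt_eqF.
by apply: contraPneq Bx => ->; rewrite set_itv1 integral_set1 => -[/esym/eqP]; rewrite gt_eqF.
Qed.

(** Moving the cut from the median to s takes the positive mass of [M, s] away from the tail; this
    makes the inequality strict. *)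
Lemma cosh_density_tail_lt s : beta_median a b < s -> s < 1 ->
  (\int[mu]_(c in `[rad_cosh s, +oo[) (cosh_density a b c)%:E <
   \int[mu]_(c in `[1%R, rad_cosh s[) (cosh_density a b c)%:E)%E.
Proof.
have [/andP[M0 M1] eqM] := beta_medianP.
move: (beta_median a b) M0 M1 eqM => M M0 M1 eqM Ms s1.
have s0 : 0 <= s by lra.
have mH (D : set R) : measurable_fun D (fun c => (cosh_density a b c)%:E).
  by apply: measurable_funTS; apply/measurable_EFinP; exact: measurable_cosh_density.
have tail r : 0 <= r -> r < 1 -> (\int[mu]_(x in `[r, 1%R]) (w x)%:E =
    2^-1%:E * \int[mu]_(c in `[rad_cosh r, +oo[) (cosh_density a b c)%:E)%E.
  move=> r0 r1; rewrite integral_beta_weight_tail//.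
  rewrite -ge0_integralZl_EFin//; last exact: mH.
  by move=> c _; rewrite lee_fin cosh_density_ge0.
have C1 := rad_cosh_ge1 s0 s1.
pose B := (\int[mu]_(c in `[rad_cosh s, +oo[) (cosh_density a b c)%:E)%E.
pose A := (\int[mu]_(c in `[1%R, rad_cosh s[) (cosh_density a b c)%:E)%E.
have tail0 : (\int[mu]_(x in `[0%R, 1%R]) (w x)%:E = 2^-1%:E * (A + B))%E.
  rewrite (tail 0 (lexx 0) ltr01) (_ : rad_cosh 0 = 1); last first.
    by rewrite /rad_cosh addr0 subr0 divr1.
  rewrite (@itv_bndbnd_setU _ _ _ (BLeft (rad_cosh s))) ?bnd_simp//.
  rewrite ge0_integral_setU//=.
  - exact: mH.
  - by move=> z _; rewrite lee_fin cosh_density_ge0.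
  - apply/disj_set2P; rewrite -subset0 => z/=; rewrite !in_itv/= => -[/andP[_ zs]].
    by rewrite andbT leNgt zs.
move: (tail s s0 s1) tail0; rewrite -[X in (X < _)%E]/B -[X in (_ < X)%E]/A -/B.
have A0 : (0 <= A)%E by apply: integral_ge0 => z _; rewrite lee_fin cosh_density_ge0.
have B0 : (0 <= B)%E by apply: integral_ge0 => z _; rewrite lee_fin cosh_density_ge0.
rewrite (integral_beta_weight_split (ltW M0) (ltW M1)) eqM.
have := integral_beta_weight_split (ltW Ms) (ltW s1).
have := integral_beta_weight_gt0 (ltW M0) Ms (ltW s1).
have : (\int[mu]_(x in `[M, 1%R]) (w x)%:E < +oo)%E.
  apply: le_lt_trans integral_beta_weight_fin.
  rewrite (integral_beta_weight_split (ltW M0) (ltW M1)) leeDr//.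
  by apply: integral_ge0 => z _; rewrite lee_fin beta_weight_ge0.
have : (0 <= \int[mu]_(x in `[s, 1%R]) (w x)%:E)%E.
  by apply: integral_ge0 => z _; rewrite lee_fin beta_weight_ge0.
move: (\int[mu]_(x in `[M, 1%R]) _)%E (\int[mu]_(x in `[s, 1%R]) _)%E (\int[mu]_(x in `[M, s]) _)%E.
have half0 : (0 < 2^-1%:E :> \bar R)%E by rewrite lte_fin invr_gt0.
(* U, V, D are the masses of [M, 1], [s, 1] and [M, s]. From B = 2 V, A + B = 4 U and U = D + V
   follows A = B + 4 D. *)
move: A B A0 B0 => [A| |] [B| |]// A0 B0 [U| |]// [V| |]// [D| |]//= _ _;
  rewrite ?(gt0_muley half0) -?EFinD -?EFinM ?lte_fin ?ltry//.
- by move=> D0 [->] [V2] [H]; lra.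
Qed.

End BetaMedian.

(** * Displacement of elements of SL2 *)

Section Geometry.
Local Open Scope complex_scope.
Variable R : realType.
Implicit Types (g h : SL2 R) (s : metaplectic R).

Definition norm2 g : R := g 0 0 ^+ 2 + g 0 1 ^+ 2 + g 1 0 ^+ 2 + g 1 1 ^+ 2.

Definition sact g : R * R * R -> R * R * R := quad (g 0 0) (g 0 1) (g 1 0) (g 1 1).

Lemma sactM g h P : sact (g * h)%g P = sact g (sact h P).
Proof. by rewrite /sact quadM !SL2_mulE. Qed.

Lemma sact1 P : sact 1%g P = P.
Proof.
case: P => [[b d] a]; rewrite /sact !mxE /=.
by congr (_, _, _); ring.
Qed.

(** This equals |g|^2 - 2, that is 2 (cosh d - 1) for the distance d from i to g.i, written as
    squares that become integers divisible by N^2 on the congruence subgroup. *)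
Definition displacement g : R := (g 0 0 - g 1 1) ^+ 2 + (g 0 1 + g 1 0) ^+ 2.

Lemma norm2E g : norm2 g = displacement g + 2.
Proof.
have e := SL2_detE g.
transitivity (displacement g + 2 * (g 0 0 * g 1 1 - g 0 1 * g 1 0)); last by rewrite e mulr1.
by rewrite /norm2 /displacement; ring.
Qed.

Lemma displacement_ge0 g : 0 <= displacement g.
Proof. by rewrite addr_ge0 ?sqr_ge0. Qed.

(* In coordinates [z |-> p z + q conj z] with [|p|^2 - |q|^2 = 1], this is
   the parallelogram law for the two terms of the [q]-part of a product. *)
Lemma displacement_le g h : displacement g <= norm2 (g * h)%g * norm2 h - 4.
Proof.
have eh := SL2_detE h; have egh := SL2_detE (g * h)%g.
rewrite -subr_ge0.
have key (a b c d a' b' c' d' : R) :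
  (a ^+ 2 + b ^+ 2 + c ^+ 2 + d ^+ 2) * (a' ^+ 2 + b' ^+ 2 + c' ^+ 2 + d' ^+ 2)
  - 4 * ((a * d - b * c) * (a' * d' - b' * c'))
  - ((a * d' - b * c' + c * b' - d * a') ^+ 2 + (b * a' - a * b' + c * d' - d * c') ^+ 2)
  = (a * a' + b * b' - c * c' - d * d') ^+ 2 + (c * a' + d * b' + b * d' + a * c') ^+ 2.
  by ring.
have := key ((g * h)%g 0 0) ((g * h)%g 0 1) ((g * h)%g 1 0) ((g * h)%g 1 1)
  (h 0 0) (h 0 1) (h 1 0) (h 1 1).
rewrite egh eh mulr1 mulr1.
set X := (X in _ - X = _); set Y := (Y in _ = Y) => e.
have -> : displacement g = X.
  rewrite /X /displacement !SL2_mulE; congr (_ ^+ 2 + _ ^+ 2).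
    transitivity ((g 0 0 - g 1 1) * (h 0 0 * h 1 1 - h 0 1 * h 1 0)); first by rewrite eh mulr1.
    by ring.
  transitivity ((g 0 1 + g 1 0) * (h 0 0 * h 1 1 - h 0 1 * h 1 0)); first by rewrite eh mulr1.
  by ring.
by rewrite e /Y addr_ge0 ?sqr_ge0.
Qed.

Lemma displacement0_SO2 g : displacement g = 0 -> SO2 g.
Proof.
move=> /eqP; rewrite paddr_eq0 ?sqr_ge0// !sqrf_eq0 => /andP[/eqP h1 /eqP h2].
have e := SL2_detE g; rewrite /SO2/=.
have e00 : g 0 0 = g 1 1 by apply/eqP; rewrite -subr_eq0 h1.
have e01 : g 0 1 = - g 1 0 by apply/eqP; rewrite -addr_eq0 h2.
apply/matrixP => i j; rewrite !mxE !big_ord_recl big_ord0 addr0 !mxE.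
have -> : lift ord0 ord0 = 1 :> 'I_2 by exact: val_inj.
have c2 (x : 'I_2) : x = 0 \/ x = 1 by case: x => [[|[|]]//] ?; [left|right]; exact: val_inj.
by case: (c2 i) => ->; case: (c2 j) => -> /=; rewrite -?e00 ?e01 -?e; rewrite ?e00 ?e01; ring.
Qed.

(** The difference of the diagonal entries and the sum of the others are multiples of N. If both
    vanish the matrix is a rotation; otherwise one of the squares is at least N^2. *)
Lemma principal_congruence_displacement N g : principal_congruence N g ->
  ~ SO2 g -> N%:R ^+ 2 <= displacement g.
Proof.
move=> [A gA Acong] nSO.
have gE i j : g i j = (A i j)%:~R by rewrite gA mxE.
have sq (u : int) : (N %| u)%Z -> u != 0 -> N%:R ^+ 2 <= (u%:~R : R) ^+ 2.
  move=> /dvdzP[q ->] qN0.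
  have q0 : q != 0 by apply: contraNneq qN0 => ->; rewrite mul0r.
  rewrite rmorphM/= exprMn ler_peMl ?sqr_ge0//.
  by rewrite -rmorphXn/= -[leLHS]/(1%:~R) ler_int -gtz0_ge1 lt_neqAle eq_sym sqrf_eq0 q0 sqr_ge0.
have d1 : (N %| (A 0 0 - A 1 1)%R)%Z.
  by rewrite -eqz_mod_dvd; apply/eqP; rewrite !Acong !mxE.
have d2 : (N %| (A 0 1 + A 1 0)%R)%Z.
  rewrite -[A 1 0]opprK -eqz_mod_dvd; apply/eqP.
  have h1 := Acong 0 1; have h2 := Acong 1 0; rewrite !mxE/= in h1 h2.
  by rewrite h1 -modzNm h2 modzNm oppr0.
have [h1|h1] := eqVneq (A 0 0 - A 1 1) 0; last first.
  by apply: le_trans (sq _ d1 h1) _; rewrite rmorphB/= -!gE lerDl sqr_ge0.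
have [h2|h2] := eqVneq (A 0 1 + A 1 0) 0; last first.
  by apply: le_trans (sq _ d2 h2) _; rewrite rmorphD/= -!gE lerDr sqr_ge0.
exfalso; apply: nSO; apply: displacement0_SO2.
by rewrite /displacement !gE -rmorphB -rmorphD/= h1 h2 /= expr0n addr0.
Qed.

(** The three equations say P = sqrt(det P) h h^T, so g P g^T is the same multiple of (gh)(gh)^T. *)
Lemma coshd_sact g h P : 0 < qdet P ->
  P.2 = Num.sqrt (qdet P) * (h 0 0 ^+ 2 + h 0 1 ^+ 2) ->
  P.1.1 = Num.sqrt (qdet P) * (h 0 0 * h 1 0 + h 0 1 * h 1 1) ->
  P.1.2 = Num.sqrt (qdet P) * (h 1 0 ^+ 2 + h 1 1 ^+ 2) ->
  coshd (sact g P) = norm2 (g * h)%g / 2.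
Proof.
pose e := qdet P; rewrite -/e => e0 h2 h11 h12; rewrite /coshd /sact qdet_quad ?SL2_detE// -/e.
have s0 : Num.sqrt e != 0 by rewrite gt_eqF// sqrtr_gt0.
have : (quad (g 0 0) (g 0 1) (g 1 0) (g 1 1) P).2 + (quad (g 0 0) (g 0 1) (g 1 0) (g 1 1) P).1.2
  = Num.sqrt e * norm2 (g * h)%g.
  clearbody e; case: P h2 h11 h12 => [[b d] a] /= -> -> ->.
  by rewrite /norm2 !SL2_mulE; ring.
move=> ->; field.
exact: s0.
Qed.

Lemma normcX4_half_pow (z : R[i]) (p : R) (n : nat) : 2 * p = n%:R ->
  `|half_pow z p| ^+ 4 = `|z| ^+ (2 * n).
Proof.
move=> pn; rewrite /half_pow (_ : twice p = n) -?exprnP; last first.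
  by rewrite /twice pn -[n%:R]/((n : int)%:~R) intrKfloor.
rewrite normrX -exprM mulnC (_ : 4 = 2 * 2)%N// -mulnA exprM -normrX sqr_sqrtc.
by [].
Qed.

Lemma normc_sqr (x y : R) : `|x +i* y| ^+ 2 = (x ^+ 2 + y ^+ 2)%:C.
Proof. by rewrite normc_def -rmorphXn/= sqr_sqrtr// addr_ge0 ?sqr_ge0. Qed.

(** With z = g.i and S = |g|^2, the squares of |z - i| and |z + i| are (S - 2) / |j|^2 and (S + 2) /
    |j|^2, and all powers of |j| cancel against the factor [mp_eta]. *)
Lemma norm_F_ (l k : nat) (m : R) s : m = 5%:R / 2%:R + l%:R ->
  `|F_ k m s| = (cosh_density (k%:R / 2%:R + 1) (m / 2%:R - 1)
                  (norm2 (mp_mx s) / 2))%:C.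
Proof.
move=> mE; pose n := (5 + 2 * l)%N.
have m2 : 2 * m = n%:R by rewrite mE /n natrD natrM; field.
have mk2 : 2 * (m + k%:R) = (n + 2 * k)%:R by rewrite mulrDr m2 natrD natrM.
have tm : twice m = n by rewrite /twice m2 -[n%:R]/((n : int)%:~R) intrKfloor.
(* Since m/2 is a quarter of the integer 2 m, fourth powers make all exponents integral. *)
apply/eqP; rewrite -(@eqrXn2 _ 4)//; last by rewrite lecR cosh_density_ge0.
clear mE; clearbody n; rewrite /F_ /f_ tm.
set H1 := half_pow (2 * 'i) m; set H2 := half_pow _ (m + k%:R).
have e1 : `|H1| ^+ 4 = `|2 * 'i : R[i]| ^+ (2 * n) by exact: normcX4_half_pow.
have := normcX4_half_pow (val (half_act (mp_mx s) (half_i R)) + 'i) mk2.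
rewrite -/H2 => e2; clearbody H1 H2.
rewrite -exprnN !(normrM, normfV) !exprMn !exprVn e1 e2.
rewrite !normrX -!exprM.
rewrite (_ : n * 4 = 2 * (2 * n))%N; last by rewrite mulnC -[4%N]/(2 * 2)%N -mulnA.
rewrite (_ : k * 4 = 2 * (2 * k))%N; last by rewrite mulnC -[4%N]/(2 * 2)%N -mulnA.
rewrite (exprM _ 2 (2 * n)) -[`|mp_eta _ _| ^+ 2]normrX mp_sqr.
set g := mp_mx s; have e := SL2_detE g.
have j0 : autj g 'i != 0 by apply: autj_neq0; exact: half_i_subproof.
set z := val _.
have J2 : `|autj g 'i| ^+ 2 = (g 1 0 ^+ 2 + g 1 1 ^+ 2)%:C.
  have -> : autj g 'i = g 1 1 +i* g 1 0 by rewrite /autj; simpc.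
  by rewrite normc_sqr addrC.
have zm : (z - 'i) * autj g 'i = (g 0 1 + g 1 0) +i* (g 0 0 - g 1 1).
  rewrite mulrBl /z /= /mobius divfK// /autj; simpc.
  by congr (_ +i* _); ring.
have zp : (z + 'i) * autj g 'i = (g 0 1 - g 1 0) +i* (g 0 0 + g 1 1).
  rewrite mulrDl /z /= /mobius divfK// /autj; simpc.
  by congr (_ +i* _); ring.
pose S := norm2 g.
have Zm : `|z - 'i| ^+ 2 = (S - 2)%:C / `|autj g 'i| ^+ 2.
  have jn : `|autj g 'i| ^+ 2 != 0 by rewrite expf_neq0// normr_eq0.
  apply: (canRL (mulfK jn)); rewrite -exprMn -normrM zm normc_sqr; congr (_%:C).
  by rewrite /S norm2E /displacement; ring.
have Zp : `|z + 'i| ^+ 2 = (S + 2)%:C / `|autj g 'i| ^+ 2.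
  have jn : `|autj g 'i| ^+ 2 != 0 by rewrite expf_neq0// normr_eq0.
  apply: (canRL (mulfK jn)); rewrite -exprMn -normrM zp normc_sqr; congr (_%:C).
  transitivity (norm2 g + 2 * (g 0 0 * g 1 1 - g 0 1 * g 1 0)); last by rewrite e mulr1.
  by rewrite /norm2; ring.
have I2 : `|2 * 'i : R[i]| ^+ 2 = 4%:C.
  rewrite (_ : 2 * 'i = 0 +i* 2); last by simpc.
  by rewrite normc_sqr expr0n add0r; congr (_%:C); ring.
rewrite -/g -[X in autj g (val X)]/(half_i R) -[val (half_i R)]/('i : R[i]).
rewrite !(exprM _ 2 n) (exprM _ 2 (n + 2 * k)) (exprM _ 2 (2 * k)) -/z.
rewrite I2 Zm Zp J2.
have J0 : g 1 0 ^+ 2 + g 1 1 ^+ 2 != 0.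
  have : `|autj g 'i| ^+ 2 != 0 by rewrite expf_neq0// normr_eq0.
  by rewrite J2; apply: contraNneq => ->.
move: (g 1 0 ^+ 2 + g 1 1 ^+ 2) J0 => J J0.
have S2 : 2 <= S by rewrite /S norm2E lerDr displacement_ge0.
rewrite -/S.
clearbody S.
rewrite -!(fmorphV (@real_complex R)) -!(rmorphM (@real_complex R)) -!(rmorphXn (@real_complex R)).
rewrite -!(fmorphV (@real_complex R)) -!(rmorphM (@real_complex R)); apply/eqP; congr (_%:C).
have Sp : 0 < S + 2 by lra.
have pow4 (x p : R) (q : nat) : 0 <= x -> p * 4 = q%:R -> (x `^ p) ^+ 4 = x ^+ q.
  by move=> x0 pq; rewrite -powR_mulrn ?powR_ge0// -powRrM pq powR_mulrn.
have uE : cosh_rad (S / 2) = (S - 2) / (S + 2).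
  by rewrite /cosh_rad; field; rewrite !gt_eqF//; lra.
have vE : 1 - cosh_rad (S / 2) = 4 / (S + 2) by rewrite uE; field; rewrite gt_eqF.
rewrite /cosh_density vE uE [RHS]exprMn.
rewrite (pow4 _ _ (2 * k)%N); first last.
- by rewrite natrM; field.
- by rewrite divr_ge0 ?subr_ge0 ?(ltW Sp).
rewrite (pow4 _ _ n); first last.
- by rewrite -m2; field.
- by rewrite divr_ge0// ltW.
have SN0 : S + 2 != 0 by rewrite gt_eqF.
rewrite !expr_div_n !exprD.
field.
by rewrite !expf_neq0.
Qed.

(** A single lift serves all g, so the translates of P become the terms of a Poincare series at one
    point. *)
Lemma cone_lift P : cone P -> exists s, forall g,
  coshd (sact g P) = norm2 (g * mp_mx s)%g / 2.
Proof.
case: P => [[b d] a] /and3P[tr0 e0 _]; rewrite /= in tr0.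
have d0 : 0 < d.
  move: e0; rewrite /qdet/= => e0.
  rewrite ltNge; apply/negP => dn; have a0 : 0 < a by lra.
  by have := mulr_ge0_le0 (ltW a0) dn; have := sqr_ge0 b; lra.
pose e := qdet (b, d, a); rewrite -/e in e0.
pose r := Num.sqrt e; have r0 : 0 < r by rewrite sqrtr_gt0.
pose y := r / d; have y0 : 0 < y by rewrite divr_gt0.
pose t := Num.sqrt y; have t0 : 0 < t by rewrite sqrtr_gt0.
have tN0 : t != 0 by rewrite gt_eqF.
have t2 : t ^+ 2 = y by rewrite sqr_sqrtr// ltW.
(* The Cholesky factor of P / sqrt(det P). Being upper triangular, it has constant automorphy factor
   1 / t, with a constant square root. *)
pose A : 'M[R]_2 := \matrix_(i, j) (if i == 0 then (if j == 0 then t else b / d / t) else (if j == 0 then 0 else t^-1)).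
have detA : \det A == 1.
  rewrite (expand_det_row _ 0) !big_ord_recl big_ord0 addr0 /cofactor !det_mx11.
  by rewrite !mxE /= expr0 expr1 !mul1r mulr0 mulr0 addr0 divff.
pose h := MkSL2 detA.
have h10 : h 1 0 = 0 by rewrite mxE.
have h11 : h 1 1 = t^-1 by rewrite mxE.
have h00 : h 0 0 = t by rewrite mxE.
have h01 : h 0 1 = b / d / t by rewrite mxE.
pose eta (z : upper_half R) : R[i] := (Num.sqrt t^-1)%:C.
have eta_holo : holomorphic eta.
  apply: (@holomorphic_ext _ _ (fun=> (Num.sqrt t^-1)%:C)) => //.
have eta_sqr z : eta z ^+ 2 = autj h (val z).
  rewrite /autj h10 h11 mul0r add0r /eta -rmorphXn/= sqr_sqrtr//.
  by rewrite invr_ge0 ltW.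
exists (MkMetaplectic eta_holo eta_sqr) => g; rewrite [mp_mx _]/=.
clearbody h.
have rd : r = y * d by rewrite /y divfK// gt_eqF.
have ad : a = (r ^+ 2 + b ^+ 2) / d.
  by rewrite sqr_sqrtr ?(ltW e0)// /e /qdet/= subrK mulfK ?gt_eqF.
apply: coshd_sact; rewrite ?h00 ?h01 ?h10 ?h11 -/e -/r ?[_.2]/= ?[_.1.1]/= ?[_.1.2]/=.
- exact: e0.
- by rewrite [LHS]ad expr_div_n t2 rd; field; rewrite !gt_eqF.
- by rewrite mulr0 add0r -mulrA -invfM -expr2 t2 rd; field; rewrite !gt_eqF.
- by rewrite expr0n add0r exprVn t2 rd; field; rewrite !gt_eqF.
Qed.

End Geometry.

(** * Integrating the translates over the ball *)

Section Unfolding.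
Variable R : realType.
Local Notation T := (measurableTypeR R).
Local Notation mu := (@lebesgue_measure R).
Local Notation mu3 := (sprod (sprod mu mu) mu).
Variables (H : R -> R) (C : R).
Hypotheses (mH : measurable_fun setT H) (H0 : forall c, 0 <= H c).

Definition ball_cone (P : R * R * R) : bool := cone P && (coshd P < C).

Definition radial (P : R * R * R) : \bar R :=
  if cone P then (H (coshd P))%:E else 0%E.

(** The determinant is invariant, and the trace stays positive since a lift makes it a positive
    multiple of some |.|^2. *)
Lemma cone_sact (g : SL2 R) P : cone (sact g P) = cone P.
Proof.
have imp (g' : SL2 R) P' : cone P' -> cone (sact g' P').
  move=> cP; have [s hs] := cone_lift cP.
  move: (cP) => /and3P[_ q0 q1]; rewrite /cone qdet_quad ?SL2_detE// q0 q1 !andbT.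
  have := hs g'; rewrite /coshd qdet_quad ?SL2_detE// => e.
  have : 0 < norm2 (g' * mp_mx s)%g / 2.
    by rewrite norm2E; have := displacement_ge0 (g' * mp_mx s)%g; lra.
  by rewrite -e pmulr_lgt0 ?invr_gt0 ?sqrtr_gt0//; lra.
apply/idP/idP => [|]; last exact: imp.
by move=> /(imp g^-1%g); rewrite -sactM mulVg sact1.
Qed.

Lemma measurable_radial : measurable_fun setT (radial : T * T * T -> \bar R).
Proof.
apply: measurable_fun_ifT; [exact: measurable_cone| |exact: measurable_cst].
by apply/measurable_EFinP; exact: measurableT_comp mH (@measurable_coshd R).
Qed.

Lemma measurable_ball_cone : measurable_fun setT (ball_cone : T * T * T -> bool).
Proof.
apply: measurable_and; first exact: measurable_cone.
apply: measurable_fun_ltr; [exact: measurable_coshd|exact: measurable_cst].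
Qed.

Lemma radial_ge0 P : (0 <= radial P)%E.
Proof. by rewrite /radial; case: ifP => // _; rewrite lee_fin. Qed.

Lemma sact_preserving (g : SL2 R) : integral_preserving mu3 mu3 (sact g).
Proof. exact: quad_preserving (SL2_detE g). Qed.

Lemma integral_radial_split : 1 <= C -> exists2 c : R, 0 < c &
  (\int[mu3]_P (if ball_cone P then radial P else 0) =
     c%:E * \int[mu]_(x in `[1%R, C[) (H x)%:E)%E /\
  (\int[mu3]_P (if ball_cone P then 0 else radial P) =
     c%:E * \int[mu]_(x in `[C, +oo[) (H x)%:E)%E.
Proof.
move=> C1; have [c c0 cone_int] := ge0_integral_cone R; exists c => //.
have mHE : measurable_fun setT (fun x => (H x)%:E) by exact/measurable_EFinP.
have mlt : measurable_fun setT (fun x : R => x < C) by exact: measurable_fun_ltr.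
split.
- have := cone_int (fun x => if x < C then (H x)%:E else 0%E) _ _.
  move=> h; transitivity (c%:E * \int[mu]_(x in `[1%R, +oo[) (if (x < C)%R then (H x)%:E else 0))%E.
    rewrite -h.
    + apply: eq_integral => P _; rewrite /ball_cone /radial.
      by case: (cone P) => //=; case: ifP.
    + by apply: measurable_fun_ifT.
    + by move=> x; case: ifP => // _; rewrite lee_fin.
  congr (_ * _)%E; rewrite integral_mkcond [RHS]integral_mkcond.
  apply: eq_integral => x _; rewrite /patch !mem_setE !in_itv/= andbT.
  by case: (1 <= x) => //=; case: (x < C).
- have := cone_int (fun x => if x < C then 0%E else (H x)%:E) _ _.
  move=> h; transitivity (c%:E * \int[mu]_(x in `[1%R, +oo[) (if (x < C)%R then 0 else (H x)%:E))%E.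
    rewrite -h.
    + apply: eq_integral => P _; rewrite /ball_cone /radial.
      by case: (cone P) => //=; case: ifP.
    + by apply: measurable_fun_ifT.
    + by move=> x; case: ifP => // _; rewrite lee_fin.
  congr (_ * _)%E; rewrite integral_mkcond [RHS]integral_mkcond.
  apply: eq_integral => x _; rewrite /patch !mem_setE !in_itv/= !andbT ltNge.
  case: (leP C x) => [Cx|xC] /=; first by rewrite (le_trans C1 Cx).
  by case: ifP.
Qed.

Variables (e : nat -> SL2 R) (p : pred nat).
Hypothesis disjoint_self : forall n P, p n -> ball_cone P -> ~~ ball_cone (sact (e n) P).
Hypothesis disjoint_translates : forall m n P Q, p m -> p n -> m != n ->
  ball_cone P -> ball_cone Q -> sact (e m) P != sact (e n) Q.

(** The contribution of the n-th element over the ball. Substituting Q = e_n P turns it into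
    [moved], which is the radial function restricted to the translated ball. *)
Let term n P : \bar R := if p n && ball_cone P then radial (sact (e n) P) else 0%E.
Let moved n Q : \bar R := if p n && ball_cone (sact (e n)^-1%g Q) then radial Q else 0%E.

Let mmoved n : measurable_fun setT (moved n : T * T * T -> \bar R).
Proof.
have [mg _] := sact_preserving (e n)^-1%g.
apply: measurable_fun_ifT; [|exact: measurable_radial|exact: measurable_cst].
apply: measurable_and; first exact: measurable_cst.
exact: measurableT_comp measurable_ball_cone mg.
Qed.

Let moved_ge0 n P : (0 <= moved n P)%E.
Proof. by rewrite /moved; case: ifP => // _; exact: radial_ge0. Qed.

Let termE n P : term n P = moved n (sact (e n) P).
Proof. by rewrite /term /moved -sactM mulVg sact1. Qed.

Let term_ge0 n P : (0 <= term n P)%E.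
Proof. by rewrite termE. Qed.

Let mterm n : measurable_fun setT (term n : T * T * T -> \bar R).
Proof.
have [mg _] := sact_preserving (e n).
rewrite (_ : term n = moved n \o sact (e n)); last by apply/funext => P; exact: termE.
exact: measurableT_comp (mmoved n) mg.
Qed.

(** A point Q lies in at most one translated ball, and in none if it lies in the ball itself. *)
Let sum_moved Q : (\sum_(n <oo) moved n Q <= if ball_cone Q then 0 else radial Q)%E.
Proof.
apply: lime_le; first exact: is_cvg_nneseries.
apply: nearW => k.
have [[n [nk pn bn]]|h] := pselect (exists n, [/\ (n < k)%N, p n & ball_cone (sact (e n)^-1%g Q)]).
  have bQ : ball_cone Q = false.
    apply/negbTE; have := disjoint_self pn bn.
    by rewrite -sactM mulgV sact1.
  rewrite bQ big_mkord (bigD1 (Ordinal nk))//= big1 ?adde0.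
    by rewrite /moved pn bn.
  move=> i ine; rewrite /moved; case: ifP => // /andP[pi bi].
  have := disjoint_translates pi pn _ bi bn; rewrite -!sactM !mulgV !sact1 eqxx.
  by move=> /(_ ine).
rewrite big_mkord big1 => [|i _]; first by case: ifP => // _; exact: radial_ge0.
rewrite /moved; case: ifP => // /andP[pi bi]; exfalso; apply: h.
by exists i; split.
Qed.

(** Were the translates to dominate at every point of the ball, integration would bound the mass
    inside the ball by the mass outside, against the tail inequality. *)
Lemma exists_dominant_point : 1 <= C ->
  (\int[mu]_(x in `[C, +oo[) (H x)%:E < \int[mu]_(x in `[1%R, C[) (H x)%:E)%E ->
  exists2 P, ball_cone P &
    (\sum_(n <oo | p n) radial (sact (e n) P) < radial P)%E.
Proof.
move=> C1 tail; have [c c0 [inE outE]] := integral_radial_split C1.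
apply: contrapT => noP.
have dom P : ((if ball_cone P then radial P else 0) <= \sum_(n <oo) term n P)%E.
  case: ifPn => [bP|_]; last by apply: nneseries_ge0 => n _ _.
  rewrite leNgt; apply/negP => lt; apply: noP; exists P => //.
  apply: le_lt_trans lt; rewrite eseries_mkcond.
  apply: lee_nneseries => [n _ _|n _]; first by case: ifP => // _; exact: radial_ge0.
  by rewrite /term bP andbT.
have m3 : measurable_fun setT (fun P : T * T * T => if ball_cone P then radial P else 0%E).
  apply: measurable_fun_ifT; [exact: measurable_ball_cone|exact: measurable_radial|exact: measurable_cst].
have m4 : measurable_fun setT (fun P : T * T * T => if ball_cone P then 0%E else radial P).
  apply: measurable_fun_ifT; [exact: measurable_ball_cone|exact: measurable_cst|exact: measurable_radial].
have : (\int[mu3]_P (if ball_cone P then radial P else 0) <=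
        \int[mu3]_P (if ball_cone P then 0 else radial P))%E.
  apply: (@le_trans _ _ (\int[mu3]_P (\sum_(n <oo) term n P))%E).
    apply: ge0_le_integral => //.
    - by move=> P _; case: ifP => // _; exact: radial_ge0.
    - exact: ge0_emeasurable_sum.
  (* Each summand needs its own change of variables, so the sum leaves the integral and re-enters it
     after the substitutions. *)
  rewrite integral_nneseries//.
  rewrite (eq_eseriesr (g := fun n => (\int[mu3]_P moved n P)%E)); last first.
    move=> n _; have [_ pres] := sact_preserving (e n).
    rewrite -(pres (moved n))//; apply: eq_integral => P _; exact: termE.
  rewrite -integral_nneseries//.
  apply: ge0_le_integral => //.
  - by move=> P _; apply: nneseries_ge0.
  - exact: ge0_emeasurable_sum.
rewrite inE outE leNgt lte_pmul2l ?lte_fin// ?tail//.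
Qed.

End Unfolding.

(* Imported only here since it rebinds [inE]. *)
From mathcomp Require Import finmap.

(** * Unordered sums *)

Section UnorderedSums.
Local Open Scope complex_scope.
Variables (R : realType) (I : choiceType).
Implicit Types J A : {fset I}.
Import summability.

Lemma fset_sum_le (u : I -> R) A J : (forall i, 0 <= u i) -> (A `<=` J)%fset ->
  \sum_(i <- A) u i <= \sum_(i <- J) u i.
Proof.
move=> u0 AJ; rewrite [leRHS](bigID (mem A))/=.
rewrite (_ : \sum_(i <- J | i \in A) u i = \sum_(i <- A) u i); last first.
  rewrite -big_filter; apply: perm_big; rewrite uniq_perm ?filter_uniq ?fset_uniq//.
  by move=> i; rewrite mem_filter; apply/andP/idP => [[]//|iA]; split=> //; exact: (fsubsetP AJ).
by rewrite lerDl sumr_ge0.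
Qed.

Lemma ge0_partial_sum_cvg (u : I -> R) (B : R) : (forall i, 0 <= u i) ->
  (forall J, \sum_(i <- J) u i <= B) ->
  exists l : R, forall e, 0 < e -> exists A, forall J, (A `<=` J)%fset ->
    `|l - \sum_(i <- J) u i| < e.
Proof.
move=> u0 uB; pose S := [set \sum_(i <- J) u i | J in [set: {fset I}]].
have hS : has_sup S.
  split; first by exists (\sum_(i <- fset0) u i), fset0.
  by exists B => _ [J _ <-].
exists (sup S) => e e0; have [_ [A _ <-] hA] := sup_adherent e0 hS.
exists A => J AJ; have h1 := fset_sum_le u0 AJ.
have h2 : \sum_(i <- J) u i <= sup S by apply: ub_le_sup; [exact: hS.2|exists J].
by rewrite ger0_norm ?subr_ge0//; lra.
Qed.

(** Write u as (|u| + u) - |u|, a difference of nonnegative families with bounded partial sums. *)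
Lemma abs_partial_sum_cvg (u : I -> R) (B : R) :
  (forall J, \sum_(i <- J) `|u i| <= B) ->
  exists l : R, forall e, 0 < e -> exists A, forall J, (A `<=` J)%fset ->
    `|l - \sum_(i <- J) u i| < e.
Proof.
move=> uB.
have B2 J : \sum_(i <- J) (`|u i| + u i) <= 2 * B.
  apply: (@le_trans _ _ (\sum_(i <- J) (2 * `|u i|))).
    by apply: ler_sum => i _; have := ler_norm (u i); lra.
  by rewrite -mulr_sumr ler_pM2l.
have [|l1 h1] := ge0_partial_sum_cvg _ B2.
  by move=> i; have := ler_norm (- u i); rewrite normrN; lra.
have [//|l2 h2] := ge0_partial_sum_cvg _ uB.
exists (l1 - l2) => e e0; have e2 : 0 < e / 2 by lra.
have [A1 H1] := h1 _ e2; have [A2 H2] := h2 _ e2.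
exists (A1 `|` A2)%fset => J; rewrite fsubUset => /andP[J1 J2].
have := H1 _ J1; have := H2 _ J2; rewrite big_split/= => H2' H1'.
set x := \sum_(i <- J) `|u i| in H1' H2'; set y := \sum_(i <- J) u i in H1' *.
have -> : l1 - l2 - y = (l1 - (x + y)) - (l2 - x) by ring.
by apply: le_lt_trans (ler_normB _ _) _; lra.
Qed.

Lemma normc_le (z : R[i]) : `|z| <= (`|complex.Re z| + `|complex.Im z|)%:C.
Proof.
case: z => a b; rewrite normc_def lecR/=.
rewrite -[leRHS]ger0_norm ?addr_ge0// -sqrtr_sqr ler_wsqrtr//.
rewrite sqrrD !real_normK ?num_real// -addrA lerD2l lerDr.
by rewrite mulrn_wge0// mulr_ge0.
Qed.

(** Convergence comes first, through real and imaginary parts, since [summability.sum] is a limit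
    operator. Then a finite sum containing i0 has modulus at least |x i0| - t, which keeps the limit
    away from 0. *)
Lemma sum_neq0 (x : I -> R[i]) (i0 : I) (t : R) :
  (forall J, i0 \notin J -> \sum_(i <- J) `|x i| <= t%:C) ->
  t%:C < `|x i0| -> summability.sum (x : I -> R[i]^o) != 0.
Proof.
move=> xt tx.
pose n i : R := complex.Re `|x i|.
have nE i : `|x i| = (n i)%:C by rewrite /n normc_def.
have tn : t < n i0 by move: tx; rewrite nE ltcR.
have nt J : i0 \notin J -> \sum_(i <- J) n i <= t.
  move=> /xt; rewrite (eq_bigr (fun i => (n i)%:C)) => [|i _]; last exact: nE.
  by rewrite -rmorph_sum lecR.
have n0 i : 0 <= n i by rewrite /n normc_def/= sqrtr_ge0.
have nB J : \sum_(i <- J) n i <= n i0 + t.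
  apply: (@le_trans _ _ (\sum_(i <- (i0 |` J)%fset) n i)).
    by apply: fset_sum_le => //; exact: fsubsetUr.
  rewrite (big_fsetD1 i0) ?fset1U1//= lerD2l nt//.
  by rewrite in_fsetD1 eqxx.
have Ren i : `|complex.Re (x i)| <= n i.
  by rewrite /n normc_def/= -sqrtr_sqr ler_wsqrtr// lerDl sqr_ge0.
have Imn i : `|complex.Im (x i)| <= n i.
  by rewrite /n normc_def/= -sqrtr_sqr ler_wsqrtr// lerDr sqr_ge0.
have [J|a ha] := @abs_partial_sum_cvg (fun i => complex.Re (x i)) (n i0 + t).
  by apply: le_trans (nB J); exact: ler_sum.
have [J|b hb] := @abs_partial_sum_cvg (fun i => complex.Im (x i)) (n i0 + t).
  by apply: le_trans (nB J); exact: ler_sum.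
have cv (e : R) : 0 < e -> exists A, forall J, (A `<=` J)%fset ->
    `|(a +i* b) - \sum_(i <- J) x i| < e%:C.
  move=> e0; have e2 : 0 < e / 2 by lra.
  have [A1 H1] := ha _ e2; have [A2 H2] := hb _ e2.
  exists (A1 `|` A2)%fset => J; rewrite fsubUset => /andP[/H1 J1 /H2 J2].
  apply: le_lt_trans (normc_le _) _; rewrite ltcR raddfB/= [X in _ + `|X|]raddfB/=.
  by rewrite !raddf_sum/= !sumrN; lra.
have FF : ProperFilter (@totally I) by exact: totally_filter.
have L : partial_sum (x : I -> R[i]^o) J @[J --> totally] --> (a +i* b : R[i]^o).
  apply/cvgrPdist_lt => e; rewrite ltcE /= => /andP[/eqP Ime Ree].
  have [A HA] := cv _ Ree; exists A => // J AJ.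
  rewrite /partial_sum -(big_seq_fsetE _ J predT x)/=.
  by apply: lt_le_trans (HA J AJ) _; rewrite lecE/= Ime eqxx lexx.
rewrite /summability.sum (cvg_lim _ L)//.
apply/eqP => ab0.
have d0 : 0 < n i0 - t by lra.
have [A HA] := cv _ d0.
have := HA (i0 |` A)%fset (fsubsetUr _ _); rewrite ab0 sub0r normrN.
rewrite (big_fsetD1 i0) ?fset1U1//=.
set y := (X in `|x i0 + X| < _) => lt.
have y_le : `|y| <= t%:C.
  apply: le_trans (ler_norm_sum _ _ _) _; apply: xt.
  by rewrite in_fsetD1 eqxx.
have : `|x i0| <= `|x i0 + y| + `|y| by rewrite -{1}(addrK y (x i0)) ler_normB.
move/le_lt_trans => /(_ _ (ltr_leD lt y_le)).
by rewrite -rmorphD/= subrK nE ltxx.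
Qed.

End UnorderedSums.

(** * From the congruence subgroup to a nonvanishing Poincare series *)

Section Discreteness.
Local Open Scope complex_scope.
Variables (R : realType) (N : nat) (G : set (metaplectic R)).
Hypothesis closedG : group_closed (mem G).
Hypothesis subG : G `<=` mp_Gamma N.
Hypothesis GK : G `&` @mp_K R = [set 1%g].

Let G1 : G 1%g.
Proof. by have [h _] := closedG; exact: set_mem h. Qed.

Let Gdiv s t : G s -> G t -> G (s * t^-1)%g.
Proof.
have [_ h] := closedG; move=> Gs Gt.
by apply: set_mem; apply: h; exact: mem_set.
Qed.

Let GM s t : G s -> G t -> G (s * t)%g.
Proof.
move=> Gs Gt; rewrite -[t]invgK; apply: Gdiv => //.
by rewrite -[t^-1%g]mul1g; exact: Gdiv.
Qed.

Lemma displacement_ge_level s : G s -> s <> 1%g -> N%:R ^+ 2 <= displacement (mp_mx s).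
Proof.
move=> Gs s1; apply: principal_congruence_displacement; first exact: subG.
by move=> sK; apply: s1; have : (G `&` @mp_K R) s by []; rewrite GK.
Qed.

(** The kernel of the double cover lies in K, and the group meets K only in the identity. *)
Lemma mp_mx_inj_in s t : G s -> G t -> mp_mx s = mp_mx t -> s = t.
Proof.
move=> Gs Gt st; have : (G `&` @mp_K R) (s * t^-1)%g.
  split; first exact: Gdiv.
  have E : mp_mx (s * t^-1)%g = 1%g by rewrite /= st mulgV.
  suff : SO2 (mp_mx (s * t^-1)%g) by [].
  by rewrite E /SO2 /= mul1mx trmx1.
rewrite GK /= => /(congr1 (fun u => (u * t)%g)).
by rewrite -mulgA mulVg mulg1 mul1g.
Qed.

(** If both points were in the ball, the two squared norms would be below 2 C, and [displacement_le]
    would give a displacement below 4 C^2 - 4 <= N^2. *)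
Lemma ball_cone_moved (C : R) s P : 4 * C ^+ 2 <= N%:R ^+ 2 + 4 -> G s -> s <> 1%g ->
  ball_cone C P -> ~~ ball_cone C (sact (mp_mx s) P).
Proof.
move=> CN Gs s1 /andP[cP hP]; apply/negP => /andP[_ hsP].
have [t ht] := cone_lift cP.
have := displacement_ge_level Gs s1.
have := displacement_le (mp_mx s) (mp_mx t).
move: hP hsP; rewrite ht -{1}(sact1 P) ht mul1g.
have n2 (g : SL2 R) : 2 <= norm2 g by rewrite norm2E lerDr displacement_ge0.
have := n2 (mp_mx t); have := n2 (mp_mx s * mp_mx t)%g.
move: (norm2 _) (norm2 _) (displacement _) => x y d.
by move=> *; nra.
Qed.

(** Countability of the group through its integral matrices; the default 0 of [xget] occurs only
    outside the preimage of the integral matrices. *)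
Definition entry_code (s : metaplectic R) : nat :=
  choice.pickle (xget (0 : 'M[int]_2) [set A : 'M[int]_2 | SL2_mx (mp_mx s) = map_mx intr A]).

Lemma entry_code_inj s t : G s -> G t -> entry_code s = entry_code t -> s = t.
Proof.
move=> Gs Gt /(pcan_inj choice.pickleK) st; apply: mp_mx_inj_in => //; apply: val_inj => /=.
have [A sA _] := subG Gs; have [B tB _] := subG Gt.
have hs := xgetPex (0 : 'M[int]_2) (ex_intro [set A : 'M[int]_2 | SL2_mx (mp_mx s) = map_mx intr A] A sA).
have ht := xgetPex (0 : 'M[int]_2) (ex_intro [set A : 'M[int]_2 | SL2_mx (mp_mx t) = map_mx intr A] B tB).
exact: (etrans hs (etrans (congr1 (map_mx intr) st) (esym ht))).
Qed.

Definition coded (n : nat) : set (metaplectic R) :=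
  [set s | [/\ G s, s <> 1%g & entry_code s = n]].

(** The identity is both excluded from [coded] and the default here; indices that code nothing are
    filtered out wherever [decode] is summed. *)
Definition decode (n : nat) : metaplectic R := xget 1%g (coded n).

Lemma decodeP n : `[< coded n !=set0 >] -> coded n (decode n).
Proof. by move=> /asboolP; exact: xgetPex. Qed.

Lemma decodeK s : G s -> s <> 1%g -> decode (entry_code s) = s.
Proof.
move=> Gs s1; have [Gd _ ed] : coded (entry_code s) (decode (entry_code s)).
  by apply: decodeP; apply/asboolP; exists s.
exact: entry_code_inj.
Qed.

Variables (H : R -> R) (C : R).
Hypotheses (mH : measurable_fun setT H) (H0 : forall c, 0 <= H c) (C1 : 1 <= C).
Hypothesis CN : 4 * C ^+ 2 <= N%:R ^+ 2 + 4.
Hypothesis tail : (\int[@lebesgue_measure R]_(x in `[C, +oo[) (H x)%:E <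
  \int[@lebesgue_measure R]_(x in `[1%R, C[) (H x)%:E)%E.

Lemma poincare_neq0 (F : metaplectic R -> R[i]) :
  (forall s, `|F s| = (H (norm2 (mp_mx s) / 2))%:C) ->
  exists s, poincare G F s != 0.
Proof.
move=> FH; pose p n := `[< coded n !=set0 >]; pose e n := mp_mx (decode n).
have self n P : p n -> ball_cone C P -> ~~ ball_cone C (sact (e n) P).
  by move=> /decodeP[Gn n1 _]; exact: ball_cone_moved.
have disj m n P Q : p m -> p n -> m != n -> ball_cone C P -> ball_cone C Q ->
    sact (e m) P != sact (e n) Q.
  move=> /decodeP[Gm m1 cm] /decodeP[Gn n1 cn] mn bP bQ; apply/eqP => eq.
  (* If e_m P = e_n Q, then the element with matrix e_n^-1 e_m, nontrivial because the codes differ,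
     moves P to Q within the ball. *)
  have Gnm : G ((decode n)^-1 * decode m)%g.
    by apply: GM => //; rewrite -[X in G X]mul1g; exact: Gdiv.
  have nm1 : ((decode n)^-1 * decode m)%g <> 1%g.
    move=> /(congr1 (fun u => decode n * u)%g); rewrite mulgA mulgV mul1g mulg1 => dd.
    by move: mn; rewrite -cm -cn dd eqxx.
  have := ball_cone_moved CN Gnm nm1 bP.
  by rewrite /= sactM -/(e m) eq /e -sactM mulVg sact1 bQ.
have [P bP domP] := exists_dominant_point mH H0 self disj C1 tail.
have /andP[cP _] := bP; have [s hs] := cone_lift cP; exists s.
have FE g : `|F (g * s)%g| = (H (coshd (sact (mp_mx g) P)))%:C by rewrite FH hs.
have radE g : radial H (sact (mp_mx g) P) = (H (coshd (sact (mp_mx g) P)))%:E.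
  by rewrite /radial cone_sact cP.
have S0 : (0 <= \sum_(n <oo | p n) radial H (sact (e n) P))%E.
  by apply: nneseries_ge0 => n _ _; exact: radial_ge0.
pose t := fine (\sum_(n <oo | p n) radial H (sact (e n) P))%E.
(* The series is finite since it is below the finite value at the dominant point. *)
have tE : (\sum_(n <oo | p n) radial H (sact (e n) P) = t%:E)%E.
  rewrite fineK// ge0_fin_numE// (lt_le_trans domP)//.
  by rewrite -(sact1 P) (radE 1%g) leey.
pose one : G := exist _ 1%g (mem_set G1).
apply: (@sum_neq0 R G (fun g : G => F (val g * s)%g) one t); last first.
  by rewrite FE ltcR -lte_fin -radE -tE (_ : mp_mx (val one) = 1%g) // sact1.
move=> J oneJ.
rewrite (eq_bigr (fun g : G => (H (coshd (sact (mp_mx (val g)) P)))%:C)) => [|g _]; last exact: FE.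
rewrite -rmorph_sum lecR -lee_fin -tE -sumEFin.
have neq1 (g : G) : g \in J -> val g <> 1%g.
  move=> gJ g1; move: oneJ; rewrite (_ : one = g) ?gJ//; exact: val_inj.
have Gval (g : G) : G (val g) by exact: set_mem (valP g).
(* Injectivity of the codes turns a finite sum over group elements into a finite part of the series
   over indices. *)
have -> : (\sum_(g <- J) (H (coshd (sact (mp_mx (val g)) P)))%:E =
    \sum_(n <- [fset entry_code (val g) | g in J]%fset | p n) radial H (sact (e n) P))%E.
  rewrite [RHS]big_mkcond eq_big_imfset/=; last first.
    by move=> g h _ _ /(entry_code_inj (Gval g) (Gval h))/val_inj.
  rewrite big_map big_seq [RHS]big_seq; apply: eq_bigr => g gJ.
  have Gg := Gval g; have g1 := neq1 _ gJ.
  rewrite ifT; first by rewrite /e (decodeK Gg g1) radE.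
  by apply/asboolP; exists (val g); split.
by apply: lee_sum_fset_lim => n _; exact: radial_ge0.
Qed.

End Discreteness.

Theorem proposition6p7 (R : realType) (N k : nat) (m : R)
    (G : set (metaplectic R)) :
  (0 < N)%N ->
  (exists l : nat, m = 5%:R / 2%:R + l%:R) ->
  group_closed (mem G) ->
  G `<=` mp_Gamma N ->
  G `&` @mp_K R = [set 1%g] ->
  let M := beta_median (k%:R / 2%:R + 1) (m / 2%:R - 1) in
  N%:R > 4%:R * Num.sqrt M / (1 - M) ->
  exists s : metaplectic R, poincare G (F_ k m) s != 0.
Proof.
move=> N0 [l ml] closedG subG GK M NM.
pose a : R := k%:R / 2%:R + 1; pose b := m / 2%:R - 1.
have a1 : 1 <= a by rewrite lerDr divr_ge0.
have b0 : 0 < b by rewrite /b ml; have : 0 <= l%:R :> R by []; lra.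
have [/andP[M0 M1] _] : is_beta_median a b M by exact: beta_medianP.
(* The positive solution of 4 C^2 = N^2 + 4, the equality case of the disjointness condition. *)
pose C : R := Num.sqrt (1 + N%:R ^+ 2 / 4).
have C2 : C ^+ 2 = 1 + N%:R ^+ 2 / 4 by rewrite sqr_sqrtr// addr_ge0// divr_ge0// sqr_ge0.
have C0 : 0 <= C by rewrite sqrtr_ge0.
have N2 : 0 < (N%:R : R) ^+ 2 by rewrite exprn_gt0// ltr0n.
have C1 : 1 < C by rewrite -(@ltr_pXn2r _ 2)// ?nnegrE// C2 expr1n ltrDl divr_gt0.
have radC : rad_cosh (cosh_rad C) = C by apply: cosh_radK; lra.
have CM : rad_cosh M < C.
  rewrite -(@ltr_pXn2r _ 2) ?nnegrE//; last first.
    by have := rad_cosh_ge1 (ltW M0) M1; lra.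
  rewrite C2; have M1' : 1 - M != 0 by rewrite gt_eqF// subr_gt0.
  (* From (1 + M)^2 = (1 - M)^2 + 4 M: the expression bounding [N] appears, and comparison with C^2
     is the hypothesis squared. *)
  have -> : rad_cosh M ^+ 2 = 1 + (4 * Num.sqrt M / (1 - M)) ^+ 2 / 4.
    rewrite !exprMn sqr_sqrtr ?ltW// /rad_cosh; field => //.
  rewrite ltrD2l ltr_pM2r ?invr_gt0// ltr_pXn2r ?nnegrE// divr_ge0 ?mulr_ge0 ?sqrtr_ge0//.
  by rewrite subr_ge0 ltW.
have MC : M < cosh_rad C.
  rewrite -(rad_coshK M1); apply: cosh_rad_lt => //.
  by have := rad_cosh_ge1 (ltW M0) M1; lra.
have C_lt1 : cosh_rad C < 1.
  by rewrite -subr_gt0 onem_cosh_rad mulr_gt0// invr_gt0; lra.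
apply: (@poincare_neq0 R N G closedG subG GK (cosh_density a b) C).
- exact: measurable_cosh_density.
- exact: cosh_density_ge0.
- exact: ltW.
- by rewrite C2; lra.
- by have := cosh_density_tail_lt a1 b0 MC C_lt1; rewrite radC.
- by move=> s; exact: (norm_F_ k s ml).
Qed.
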